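(* Let $r>0$ and let $\lambda_1$ be the first eigenvalue of the Laplacian $-\Delta$, with Dirichlet boundary conditions, on a geodesic ball of radius $r$ in $\mathbb{H}^n$. For $n>3$, $$\lambda_1 > \frac{(n-1)^2}{4} + \frac{\pi^2}{r^2} + \frac{(n-1)(n-3)}{4\sinh^2 r}.$$ For $n=2$, $$\lambda_1 \le \frac14 + \frac{\pi^2}{r^2} - \frac{1}{4\sinh^2 r}.$$
   Context: $\mathbb{H}^n$ is the $n$-dimensional hyperbolic space of constant sectional curvature $-1$. *)

(* Defs.v *)
From mathcomp Require Import all_boot all_order all_algebra.
From mathcomp Require Import all_classical all_reals all_analysis.

Set Implicit Arguments.
Unset Strict Implicit.
Unset Printing Implicit Defensive.

Import Order.TTheory GRing.Theory Num.Theory.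
Import numFieldNormedType.Exports.

Local Open Scope classical_set_scope.
Local Open Scope ring_scope.

Definition sinh {R : realType} (x : R) : R := (expR x - expR (- x)) / 2.

(* Riemannian geometry in a single global chart: the manifold is a subset [U]
   of R^n and the metric is a matrix field [g], with [g x] the Gram matrix of
   the coordinate vector fields at [x]. *)
Section Riemannian.
Context {R : realType} {n : nat}.
Implicit Types (U B : set 'rV[R]_n) (g : 'rV[R]_n -> 'M[R]_n).
Implicit Types (u : 'rV[R]_n -> R) (x v p : 'rV[R]_n) (c : R -> 'rV[R]_n).

Definition riem_norm g x v : R := Num.sqrt ((v *m g x *m v^T) 0 0).

(* A C^1 curve on [0, 1] extends to a C^1 function on R, so nothing is lost by
   taking curves defined on all of R; only their values on [0, 1] matter. *)
Definition C1_path U p x c : Prop :=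
  [/\ (forall t : R, derivable c t 1), continuous (derive1 c),
      (forall t : R, t \in `[0, 1] -> U (c t)), c 0 = p & c 1 = x].

Definition riem_length g c : \bar R :=
  \int[lebesgue_measure]_(t in `[0, 1]) (riem_norm g (c t) (derive1 c t))%:E.

Definition riem_dist U g p x : \bar R :=
  ereal_inf [set riem_length g c | c in C1_path U p x].

Definition geodesic_ball U g p (r : R) : set 'rV[R]_n :=
  [set x | U x /\ (riem_dist U g p x < r%:E)%E].

Definition partial (i : 'I_n) u : 'rV[R]_n -> R :=
  fun x => 'D_(delta_mx 0 i) u x.

Definition C2_on B u : Prop :=
  forall x, B x -> forall i j : 'I_n,
    [/\ derivable u x (delta_mx 0 i), {for x, continuous (partial i u)},
        derivable (partial i u) x (delta_mx 0 j)
      & {for x, continuous (partial j (partial i u))}].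

(* Laplace-Beltrami operator, with the sign convention div o grad (so the
   eigenvalues below are those of its opposite). *)
Definition laplacian g u x : R :=
  (Num.sqrt (\det (g x)))^-1 *
  \sum_(i < n) partial i (fun y =>
     Num.sqrt (\det (g y)) * \sum_(j < n) invmx (g y) i j * partial j u y) x.

(* Classical Dirichlet eigenvalues of a domain [B] with compact closure in [U]:
   the eigenfunction is C^2 in [B], continuous up to the boundary, vanishes
   there, and is not identically zero. Values outside [closure B] are junk. *)
Definition dirichlet_eigenvalue g B (lambda : R) : Prop :=
  exists u,
    [/\ C2_on B u, {within closure B, continuous u},
        (forall x, (closure B `\` B°) x -> u x = 0),
        (exists2 x, B x & u x != 0)
      & forall x, B x -> - laplacian g u x = lambda * u x].

Definition first_dirichlet_eigenvalue g B (lambda1 : R) : Prop :=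
  dirichlet_eigenvalue g B lambda1 /\
  forall mu, dirichlet_eigenvalue g B mu -> lambda1 <= mu.

End Riemannian.

(* Hyperbolic n-space of curvature -1, as the Poincare ball: the Euclidean unit
   ball with metric 4 |dx|^2 / (1 - |x|^2)^2. The Euclidean norm is spelled out
   because the library norm on row vectors is the sup norm. *)
Section Hyperbolic.
Context {R : realType} {n : nat}.

Definition sqnorm (x : 'rV[R]_n) : R := \sum_(i < n) x 0 i ^+ 2.

Definition hyp_space : set 'rV[R]_n := [set x | sqnorm x < 1].

Definition hyp_metric (x : 'rV[R]_n) : 'M[R]_n :=
  (4 / (1 - sqnorm x) ^+ 2)%:M.

Definition hyp_ball (p : 'rV[R]_n) (r : R) : set 'rV[R]_n :=
  geodesic_ball hyp_space hyp_metric p r.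

End Hyperbolic.

(* Main.v *)
(** In the Poincare ball, [C x = 1 + 2 |x - p|^2 / ((1 - |x|^2) (1 - |p|^2))] is
    the hyperbolic cosine of the distance from [p] to [x]: it satisfies
    [|grad C|^2 = C^2 - 1], which bounds lengths of paths from below, and the
    projected hyperboloid geodesics attain the bound.  Together with
    [laplacian C = n C] this reduces the Laplacian of a function of the distance
    [t] to [f'' + (n - 1) coth t f'].

    For [n > 3], write [f = g / sinh^((n-1)/2)], so that
    [- laplacian f = (- g'' + ((n-1)^2/4 + (n-1)(n-3)/(4 sinh^2)) g) / sinh^((n-1)/2)].
    With [g = sin (pi t / r) + d cos (2 pi t / r)] and [d > 0] small, [f] is a
    positive strict supersolution up to the boundary, infinite at [p]; at a
    maximum of [|u| / f], for an eigenfunction [u], the bound can be read off.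

    For [n = 2], the radial solution of [- laplacian y = l y] is a power series in
    [tanh^2 (t / 2)].  At the claimed bound, the Wronskian of [sqrt (sinh t) y] and
    [sin (pi t / r)] decreases from 0, so [y] is not positive on [[0, r]].  For the
    least [mu] with that property, [y] is nonnegative, hence nonincreasing, hence
    vanishes exactly at [r]: [mu] is an eigenvalue, and the first one is at most
    [mu]. *)

Require Import Defs.
From mathcomp Require Import all_boot all_order all_algebra.
From mathcomp Require Import all_classical all_reals all_analysis.
From mathcomp Require Import ring lra.
Import Order.TTheory GRing.Theory Num.Theory.
Import numFieldNormedType.Exports.
Local Open Scope classical_set_scope.
Local Open Scope ring_scope.
Set Implicit Arguments.
Unset Strict Implicit.
Unset Printing Implicit Defensive.

(** * Derivatives and local maxima *)

(** The sign of [(n - 1)(n - 3)] decides the direction of the bound. Once the weight is removed, the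
    potential [(n - 1)(n - 3) / (4 sinh^2 t)] decreases to its value at [r] when [n > 3] and
    increases to it when [n = 2]. Freezing it at [r] leaves [sin (pi t / r)] as comparison function,
    whence both bounds.

    No variational characterisation of eigenvalues is used. The lower bound is proved for every
    classical eigenvalue, so nothing has to be known about the sign of a first eigenfunction. The
    upper bound exhibits an actual eigenvalue, since a first eigenvalue is only known to lie below
    all the others.

    With [d = 0] the supersolution would vanish at distance [r], and its strictness would degenerate
    there. The second harmonic cures both: it is positive near both ends of [[0, r]], and its larger
    frequency gives a strict inequality where the potential no longer helps. Since [f] is infinite
    at [p], the maximum of [|u| / f] stays away from the point where the distance is not smooth. *)

Section DerivativeRules.
Context {R : realType} {V : normedModType R}.
Implicit Types (f g : V -> R) (x v : V).

(** Carries directional derivatives over to one-variable calculus, where the chain rule and the mean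
    value theorem live. *)
Lemma is_derive_line {W : normedModType R} (f : V -> W) x v (d : W) :
  is_derive x v f d <-> is_derive (0 : R) 1 (fun h : R => f (h *: v + x)) d.
Proof.
have e : 'D_v f x = 'D_1 (fun h : R => f (h *: v + x)) 0.
  rewrite /derive; set g1 := fun h => h^-1 *: _; set g2 := fun h => h^-1 *: _.
  suff -> : g1 = g2 by [].
  by apply/funext => h; rewrite /g1 /g2/= addr0 scale0r add0r [_%:A]mulr1.
split => -[df dv]; (split; last by move: dv; rewrite e).
  exact/(derivable1P f x v).1.
exact/(derivable1P f x v).2.
Qed.

(** This rule and the following ones are phrased for functions written pointwise, so that derivative
    proofs can be assembled as terms and the value adjusted at the end. *)
Lemma is_derive_const (a : R) x v : is_derive x v (fun=> a) 0.
Proof. exact: is_derive_cst. Qed.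

Lemma is_derive_val f x v (a b : R) : is_derive x v f a -> a = b ->
  is_derive x v f b.
Proof. by move=> ? <-. Qed.

Lemma is_derive_add f g x v (a b : R) : is_derive x v f a -> is_derive x v g b ->
  is_derive x v (fun y => f y + g y) (a + b).
Proof. exact: is_deriveD. Qed.

Lemma is_derive_sub f g x v (a b : R) : is_derive x v f a -> is_derive x v g b ->
  is_derive x v (fun y => f y - g y) (a - b).
Proof. exact: is_deriveB. Qed.

Lemma is_derive_mul f g x v (a b : R) : is_derive x v f a -> is_derive x v g b ->
  is_derive x v (fun y => f y * g y) (f x * b + g x * a).
Proof. exact: is_deriveM. Qed.

Lemma is_derive_exp f n x v (a : R) : is_derive x v f a ->
  is_derive x v (fun y => f y ^+ n) (n%:R * f x ^+ n.-1 * a).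
Proof.
move=> df; have -> : (fun y => f y ^+ n) = f ^+ n.
  by apply/funext => y; rewrite exprfctE.
exact: is_deriveX.
Qed.

Lemma is_derive_scale f x v (k a : R) : is_derive x v f a ->
  is_derive x v (fun y => k * f y) (k * a).
Proof. exact: is_deriveZ. Qed.

Lemma is_derive_inv f x v (a : R) : is_derive x v f a -> f x != 0 ->
  is_derive x v (fun y => (f y)^-1) (- a / f x ^+ 2).
Proof.
move=> [df dv] fx0; split; first exact: derivableV.
by rewrite deriveV// dv /GRing.scale/= !mulNr mulrC.
Qed.

Lemma is_derive_compR f (g : R -> R) x v (a b : R) :
  is_derive x v f a -> is_derive (f x) 1 g b ->
  is_derive x v (fun y => g (f y)) (b * a).
Proof.
move=> /is_derive_line df dg; apply/is_derive_line.
apply: (@is_derive1_comp R g (fun h : R => f (h *: v + x)) 0 b a).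
by rewrite scale0r add0r.
Qed.

Lemma is_derive_bigsum n (h : 'I_n -> V -> R) x v (dh : 'I_n -> R) :
  (forall i, is_derive x v (h i) (dh i)) ->
  is_derive x v (fun y => \sum_(i < n) h i y) (\sum_(i < n) dh i).
Proof.
move=> H; have := is_derive_sum H.
by congr (is_derive _ _ _ _); apply/funext => y; rewrite fct_sumE.
Qed.

Lemma continuous_at_const (a : R) x : {for x, continuous (fun=> a : R)}.
Proof. exact: cst_continuous. Qed.

Lemma continuous_at_add f g x : {for x, continuous f} -> {for x, continuous g} ->
  {for x, continuous (fun y => f y + g y)}.
Proof. exact: continuousD. Qed.

Lemma continuous_at_sub f g x : {for x, continuous f} -> {for x, continuous g} ->
  {for x, continuous (fun y => f y - g y)}.
Proof. exact: continuousB. Qed.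

Lemma continuous_at_mul f g x : {for x, continuous f} -> {for x, continuous g} ->
  {for x, continuous (fun y => f y * g y)}.
Proof. exact: continuousM. Qed.

Lemma continuous_at_inv f x : f x != 0 -> {for x, continuous f} ->
  {for x, continuous (fun y => (f y)^-1)}.
Proof. exact: continuousV. Qed.

Lemma continuous_at_sum n (h : 'I_n -> V -> R) x :
  (forall i, {for x, continuous (h i)}) ->
  {for x, continuous (fun y => \sum_(i < n) h i y)}.
Proof.
by move=> ch; apply: cvg_big => //; [exact: add_continuous|move=> i _; exact: ch].
Qed.

Lemma continuous_at_exp f n x : {for x, continuous f} ->
  {for x, continuous (fun y => f y ^+ n)}.
Proof.
move=> cf; exact: (@continuous_comp _ _ _ f (fun t => t ^+ n) x cf
  (@exprn_continuous R n (f x))).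
Qed.

End DerivativeRules.

Lemma is_derive_continuous {R : realType} (f : R -> R) (x a : R) :
  is_derive x 1 f a -> {for x, continuous f}.
Proof. by move=> [df _]; exact/differentiable_continuous/derivable1_diffP. Qed.

Lemma is_derive_within {R : realType} (f f1 : R -> R) (a b : R) :
  (forall x, a <= x <= b -> is_derive x 1 f (f1 x)) ->
  {within `[a, b], continuous f}.
Proof.
move=> df; apply: continuous_in_subspaceT => x.
by rewrite inE/= in_itv/= => xab; exact: is_derive_continuous (df _ xab).
Qed.

Lemma nonincreasing_of_is_derive {R : realType} (f f1 : R -> R) (a b : R) :
  (forall x, a <= x <= b -> is_derive x 1 f (f1 x)) ->
  (forall x, a <= x <= b -> f1 x <= 0) ->
  forall x y, a <= x -> x <= y -> y <= b -> f y <= f x.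
Proof.
move=> df f1le x y ax xy yb.
have d1 z : z \in `]a, b[ -> a <= z <= b.
  by rewrite in_itv/= => /andP[/ltW -> /ltW ->].
apply: (@ler0_derive1_le_cc R f a b) => //.
- by move=> z /d1 /df [].
- by move=> z /d1 zab; rewrite derive1E (@derive_val _ _ _ _ _ _ _ (df _ zab)) f1le.
- exact: is_derive_within df.
- by rewrite in_itv/= (le_trans ax xy) yb.
- by rewrite in_itv/= ax (le_trans xy yb).
Qed.

Lemma nondecreasing_of_is_derive {R : realType} (f f1 : R -> R) (a b : R) :
  (forall x, a <= x <= b -> is_derive x 1 f (f1 x)) ->
  (forall x, a <= x <= b -> 0 <= f1 x) ->
  forall x y, a <= x -> x <= y -> y <= b -> f x <= f y.
Proof.
move=> df f1ge x y ax xy yb; rewrite -lerN2.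
apply: (@nonincreasing_of_is_derive R (fun z => - f z) (fun z => - f1 z) a b) => //.
- by move=> z zab; apply: is_deriveN; exact: df.
- by move=> z zab; rewrite oppr_le0 f1ge.
Qed.

(** If [g2] were positive, the difference quotients of [g1] at 0 would make [g1] positive on some
    [(0, d]], and the mean value theorem would give [g d > g 0]. *)
Lemma local_max_derive2 {R : realType} (g g1 : R -> R) (g2 : R) :
  (\forall h \near (0 : R), is_derive (h : R) 1 g (g1 h)) ->
  (\forall h \near (0 : R), g h <= g 0) ->
  is_derive (0 : R) 1 g1 g2 -> g1 0 = 0 /\ g2 <= 0.
Proof.
move=> dg gmax dg1.
have /nbhs_ballP[e /= e0 He] : \forall h \near (0 : R),
    is_derive (h : R) 1 g (g1 h) /\ g h <= g 0 by near=> h; split; near: h.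
have He' h : `|h| < e -> is_derive (h : R) 1 g (g1 h) /\ g h <= g 0.
  by move=> he; apply: He; rewrite /ball/= sub0r normrN.
have g10 : g1 0 = 0.
  have itv t : t \in `]-e, e[ -> `|t| < e by rewrite in_itv/= -ltr_norml.
  have e0m : - e <= e by lra.
  have o0 : (0 : R) \in `]-e, e[ by rewrite in_itv/= oppr_lt0 e0.
  have D : is_derive (0 : R) 1 g 0.
    apply: (@derive1_at_max R g (- e) e 0) => //.
    - by move=> t /itv /He' [[]].
    - by move=> t /itv /He' [].
  have [+ _] := He' 0 ltac:(by rewrite normr0).
  by move=> [_ <-]; case: D => _ ->.
split => //; rewrite leNgt; apply/negP => g2gt0.
have := (@ex_derive _ _ _ _ _ _ _ dg1); rewrite /derivable => /cvg_ex[l lP].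
have el : l = g2.
  by move/(cvg_lim (@Rhausdorff R)) : (lP) => <-; case: dg1.
rewrite el in lP.
have /nbhs_ballP[e' /= e'0 He2] : \forall h \near (0 : R)^',
    0 < h^-1 *: ((g1 \o shift 0) (h *: 1) - g1 0).
  exact: (cvgr_gt _ lP).
pose d := Num.min e e' / 2.
have d0 : 0 < d by rewrite divr_gt0// lt_min e0.
have de : d < e.
  have := ge_min e e e'; rewrite lexx /= => h.
  by rewrite /d; lra.
have de' : d < e'.
  have : Num.min e e' <= e' by rewrite ge_min lexx orbT.
  by rewrite /d; lra.
have g1pos h : 0 < h <= d -> 0 < g1 h.
  move=> /andP[h0 hd].
  have := He2 h; rewrite /ball/= sub0r normrN gtr0_norm// (le_lt_trans hd de').
  move=> /(_ isT (lt0r_neq0 h0)).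
  by rewrite g10 subr0 addr0 [_%:A]mulr1 pmulr_rgt0 ?invr_gt0.
have dgc x : 0 <= x <= d -> is_derive (x : R) 1 g (g1 x).
  by move=> /andP[x0 xd]; apply: (He' x _).1; rewrite ger0_norm// (le_lt_trans xd).
have dgo x : x \in `]0, d[ -> is_derive (x : R) 1 g (g1 x).
  by rewrite in_itv/= => /andP[x0 xd]; apply: dgc; rewrite !ltW.
have [c] := @MVT R g g1 0 d d0 dgo (is_derive_within dgc).
rewrite in_itv/= => /andP[c0 cd] E.
have : 0 < g d - g 0.
  by rewrite E subr0 mulr_gt0// g1pos// c0 ltW.
by rewrite subr_gt0 ltNge (He' d _).2// gtr0_norm.
Unshelve. all: by end_near. Qed.

Lemma is_derive_coord {R : realType} {n : nat} (x : 'rV[R]_n) (i j : 'I_n) :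
  is_derive x (delta_mx 0 i) (fun y : 'rV[R]_n => y 0 j) (j == i)%:R.
Proof.
have H := @is_derive_id R 'rV[R]_n x (delta_mx 0 i).
have Hd : derivable (id : 'rV[R]_n -> 'rV[R]_n) x (delta_mx 0 i) by case: H.
split; first by move/derivable_mxP : Hd => /(_ 0 j).
have := derive_mx Hd; rewrite derive_id => /matrixP /(_ 0 j).
by rewrite !mxE eqxx /= => ->.
Qed.

(** * The hyperbolic Laplacian *)

Section HyperbolicLaplacian.
Context {R : realType} {n : nat}.
Implicit Types (x y p : 'rV[R]_n) (u : 'rV[R]_n -> R).

Lemma sqnorm_ge0 x : 0 <= sqnorm x.
Proof. by apply: sumr_ge0 => i _; rewrite sqr_ge0. Qed.

Lemma sqnorm_eq0 x : sqnorm x = 0 -> x = 0.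
Proof.
move=> /eqP; rewrite psumr_eq0; last by move=> i _; rewrite sqr_ge0.
move=> /allP h; apply/rowP => i; rewrite mxE.
by have := h i (mem_index_enum _); rewrite sqrf_eq0 => /eqP.
Qed.

Definition dotv x y : R := \sum_(i < n) x 0 i * y 0 i.

(** Coordinate sums in the gradient and Laplacian computations are brought to this shape; what
    remains is an identity in [sqnorm x], [dotv x p] and [sqnorm p] within reach of [field]. The
    constant term is where the dimension enters. *)
Lemma sum_quadratic x p (a b c d : R) :
  \sum_(i < n) (a * x 0 i ^+ 2 + b * (x 0 i * p 0 i) + c * p 0 i ^+ 2 + d)
  = a * sqnorm x + b * dotv x p + c * sqnorm p + n%:R * d.
Proof.
by rewrite !big_split/= -!mulr_sumr sumr_const card_ord mulr_natl.
Qed.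

Lemma sqnormB x p : sqnorm (x - p) = sqnorm x - 2 * dotv x p + sqnorm p.
Proof.
have := sum_quadratic x p 1 (- 2) 1 0; rewrite !mul1r mulr0 addr0 mulNr => <-.
by apply: eq_bigr => i _; rewrite !mxE; ring.
Qed.

Lemma sqnorm_continuous p : continuous (fun x : 'rV[R]_n => sqnorm (x - p)).
Proof.
apply: continuous_big => //; first exact: add_continuous.
move=> i _ x.
have -> : (fun y : 'rV[R]_n => (y - p) 0 i ^+ 2)
    = fun y => (y 0 i - p 0 i) * (y 0 i - p 0 i).
  by apply/funext => y; rewrite !mxE expr2.
have H : {for x, continuous (fun y : 'rV[R]_n => y 0 i - p 0 i)}.
  have Hi : {for x, continuous (fun y : 'rV[R]_n => y 0 i)} by exact: coord_continuous.
  have Hc : {for x, continuous (fun y : 'rV[R]_n => p 0 i)} by exact: cst_continuous.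
  exact: (continuousB Hi Hc).
exact: (continuousM H H).
Qed.

Lemma hyp_space_open : open (@hyp_space R n).
Proof.
have -> : @hyp_space R n = (fun x => sqnorm (x - 0)) @^-1` [set t | t < 1].
  by apply/seteqP; split => x /=; rewrite subr0.
apply: open_comp; last exact: open_lt.
by move=> x _; exact: sqnorm_continuous.
Qed.

Lemma is_derive_sqnormB p x i : is_derive x (delta_mx 0 i)
  (fun y => sqnorm (y - p)) (2 * (x 0 i - p 0 i)).
Proof.
have H (j : 'I_n) : is_derive x (delta_mx 0 i)
    (fun y : 'rV[R]_n => (y - p) 0 j ^+ 2) (2 * (x 0 j - p 0 j) * (j == i)%:R).
  have e : (fun y : 'rV[R]_n => (y - p) 0 j ^+ 2) = fun y => (y 0 j - p 0 j) ^+ 2.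
    by apply/funext => y; rewrite !mxE.
  rewrite e; apply: is_derive_eq.
    apply: is_derive_exp; apply: is_derive_sub; first exact: is_derive_coord.
  by rewrite /= subr0 expr1.
apply: is_derive_eq; first exact: (is_derive_bigsum H).
rewrite (bigD1 i)//= eqxx mulr1 big1 ?addr0// => j /negbTE ->.
by rewrite mulr0.
Qed.

Lemma is_derive_conf x i : is_derive x (delta_mx 0 i)
  (fun y => 1 - sqnorm y) (- (2 * x 0 i)).
Proof.
have e : @sqnorm R n = fun y => sqnorm (y - 0) by apply/funext => y; rewrite subr0.
rewrite e; apply: is_derive_eq.
  apply: is_derive_sub.
  exact: is_derive_sqnormB.
by rewrite mxE subr0 sub0r.
Qed.

Lemma sqrt_det_hyp_metric x : hyp_space x ->
  Num.sqrt (\det (hyp_metric x)) = (2 / (1 - sqnorm x)) ^+ n.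
Proof.
rewrite /hyp_space/= => x1; rewrite det_scalar.
have -> : 4 / (1 - sqnorm x) ^+ 2 = (2 / (1 - sqnorm x)) ^+ 2 by field; lra.
rewrite exprAC sqrtr_sqr ger0_norm// exprn_ge0// divr_ge0//; lra.
Qed.

(** The metric is [phi^2] times the identity with [phi = 2 / (1 - |x|^2)], so [sqrt (det g) g^-1] is
    the scalar [phi^(n-2)], whose logarithmic derivative along axis [i] is [(n - 2)] times
    [2 x_i / (1 - |x|^2)]. *)
Lemma laplacian_hypE u x : hyp_space x ->
  (forall i, derivable (partial i u) x (delta_mx 0 i)) ->
  laplacian hyp_metric u x = (1 - sqnorm x) ^+ 2 / 4 *
    \sum_(i < n) (partial i (partial i u) x +
      (n%:R - 2) * (2 * x 0 i / (1 - sqnorm x)) * partial i u x).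
Proof.
move=> xU du; rewrite /laplacian sqrt_det_hyp_metric//.
have x1 : sqnorm x < 1 := xU.
have D0 : 1 - sqnorm x != 0 by lra.
rewrite !mulr_sumr; apply: eq_bigr => i _.
(* This is [phi^(n-2)], written as [phi^n / phi^2] because [n - 2] may be negative. *)
pose A (y : 'rV[R]_n) : R := (2 / (1 - sqnorm y)) ^+ n * ((1 - sqnorm y) ^+ 2 / 4).
have Anear : \forall y \near x, A y * partial i u y =
    Num.sqrt (\det (hyp_metric y)) *
    (\sum_(j < n) invmx (hyp_metric y) i j * partial j u y).
  near=> y.
  have yU : hyp_space y by near: y; exact: open_nbhs_nbhs (conj hyp_space_open xU).
  have y1 : sqnorm y < 1 := yU.
  rewrite sqrt_det_hyp_metric// /A -mulrA; congr (_ * _).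
  rewrite invmx_scalar (bigD1 i)//= big1 ?addr0.
    by rewrite !mxE eqxx mulr1n invf_div.
  by move=> j /negbTE ji; rewrite !mxE eq_sym ji mulr0n mul0r.
have dA : is_derive x (delta_mx 0 i) A
    ((2 / (1 - sqnorm x)) ^+ n * ((1 - sqnorm x) ^+ 2 / 4) *
     ((n%:R - 2) * (2 * x 0 i / (1 - sqnorm x)))).
  apply: is_derive_eq.
    apply: is_derive_mul.
      apply: is_derive_exp; apply: is_derive_scale.
      by apply: is_derive_inv => //; exact: is_derive_conf.
    apply: is_derive_mul.
    by apply: is_derive_exp; exact: is_derive_conf.
  rewrite mulr0 add0r /= expr1.
  have e : n%:R * (2 / (1 - sqnorm x)) ^+ n.-1 =
      n%:R * (2 / (1 - sqnorm x)) ^+ n * ((1 - sqnorm x) / 2).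
    case: (n) (1 - sqnorm x) D0 => [|m] D D0; first by rewrite !mul0r.
    by rewrite exprS/=; field.
  by rewrite e; field.
have dP := derivableP (du i).
have := near_eq_is_derive Anear (is_derive_mul dA dP).
move=> [_]; rewrite /partial => ->.
by rewrite /A; field; rewrite D0 /= expf_neq0// mulf_neq0// invr_neq0.
Unshelve. all: by end_near. Qed.

Definition hypcosh p x : R :=
  1 + 2 * sqnorm (x - p) / ((1 - sqnorm x) * (1 - sqnorm p)).

Definition dhypcosh p (i : 'I_n) x : R := 4 / (1 - sqnorm p) *
  ((x 0 i - p 0 i) / (1 - sqnorm x)
   + sqnorm (x - p) * x 0 i / (1 - sqnorm x) ^+ 2).

Definition ddhypcosh p (i j : 'I_n) x : R := 4 / (1 - sqnorm p) *
  ((i == j)%:R / (1 - sqnorm x)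
   + 2 * (x 0 i - p 0 i) * x 0 j / (1 - sqnorm x) ^+ 2
   + 2 * (x 0 j - p 0 j) * x 0 i / (1 - sqnorm x) ^+ 2
   + sqnorm (x - p) * (i == j)%:R / (1 - sqnorm x) ^+ 2
   + 4 * sqnorm (x - p) * x 0 i * x 0 j / (1 - sqnorm x) ^+ 3).

Lemma hypcosh_ge1 p x : hyp_space p -> hyp_space x -> 1 <= hypcosh p x.
Proof.
rewrite /hyp_space/= => p1 x1; rewrite /hypcosh lerDl divr_ge0//.
  by rewrite mulr_ge0// sqnorm_ge0.
by rewrite mulr_ge0//; lra.
Qed.

Lemma hypcosh_gt1 p x : hyp_space p -> hyp_space x -> x != p -> 1 < hypcosh p x.
Proof.
rewrite /hyp_space/= => p1 x1 xp; rewrite /hypcosh ltrDl divr_gt0//.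
  rewrite mulr_gt0// lt_def sqnorm_ge0 andbT.
  by apply: contra_neq xp => /sqnorm_eq0 /subr0_eq.
by rewrite mulr_gt0//; lra.
Qed.

Lemma hypcoshxx p : hypcosh p p = 1.
Proof.
rewrite /hypcosh subrr [X in 2 * X]big1 ?mulr0 ?mul0r ?addr0// => i _.
by rewrite mxE expr0n.
Qed.

Lemma conf_continuous x : {for x, continuous (fun y : 'rV[R]_n => 1 - sqnorm y)}.
Proof.
have e : @sqnorm R n = fun y => sqnorm (y - 0) by apply/funext => y; rewrite subr0.
rewrite e; apply: continuous_at_sub; first exact: continuous_at_const.
exact: sqnorm_continuous.
Qed.

Lemma hypcosh_continuous p x : hyp_space p -> hyp_space x ->
  {for x, continuous (hypcosh p)}.
Proof.
rewrite /hyp_space/= => p1 x1.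
apply: continuous_at_add; first exact: continuous_at_const.
apply: continuous_at_mul.
  apply: continuous_at_mul; first exact: continuous_at_const.
  exact: sqnorm_continuous.
apply: continuous_at_inv; first by rewrite mulf_neq0//; lra.
apply: continuous_at_mul; [exact: conf_continuous|exact: continuous_at_const].
Qed.

Lemma dhypcosh_continuous p i x : hyp_space p -> hyp_space x ->
  {for x, continuous (dhypcosh p i)}.
Proof.
rewrite /hyp_space/= => p1 x1.
have cx : {for x, continuous (fun y : 'rV[R]_n => y 0 i)} by exact: coord_continuous.
have D0 : 1 - sqnorm x != 0 by lra.
apply: continuous_at_mul; first exact: continuous_at_const.
apply: continuous_at_add.
  apply: continuous_at_mul.
    apply: continuous_at_sub => //; exact: continuous_at_const.
  by apply: continuous_at_inv => //; exact: conf_continuous.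
apply: continuous_at_mul.
  by apply: continuous_at_mul => //; exact: sqnorm_continuous.
apply: continuous_at_inv; first by rewrite expf_neq0.
by apply: continuous_at_exp; exact: conf_continuous.
Qed.

Lemma ddhypcosh_continuous p i j x : hyp_space p -> hyp_space x ->
  {for x, continuous (ddhypcosh p i j)}.
Proof.
rewrite /hyp_space/= => p1 x1.
have cx k : {for x, continuous (fun y : 'rV[R]_n => y 0 k)} by exact: coord_continuous.
have cc (a : R) : {for x, continuous (fun y : 'rV[R]_n => a)}.
  exact: continuous_at_const.
have D0 : 1 - sqnorm x != 0 by lra.
have cN : {for x, continuous (fun y : 'rV[R]_n => sqnorm (y - p))}.
  exact: sqnorm_continuous.
have cD m : {for x, continuous (fun y : 'rV[R]_n => ((1 - sqnorm y) ^+ m)^-1)}.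
  apply: continuous_at_inv; first by rewrite expf_neq0.
  by apply: continuous_at_exp; exact: conf_continuous.
apply: continuous_at_mul => //.
apply: continuous_at_add; [apply: continuous_at_add;
  [apply: continuous_at_add; [apply: continuous_at_add|]|]|];
  (apply: continuous_at_mul; last by [exact: cD|exact: (cD 1%N)]) => //.
- by apply: continuous_at_mul => //; apply: continuous_at_mul => //;
    exact: continuous_at_sub.
- by apply: continuous_at_mul => //; apply: continuous_at_mul => //;
    exact: continuous_at_sub.
- exact: continuous_at_mul.
- by apply: continuous_at_mul => //; apply: continuous_at_mul => //;
    exact: continuous_at_mul.
Qed.

Lemma is_derive_hypcosh p x i : hyp_space p -> hyp_space x ->
  is_derive x (delta_mx 0 i) (hypcosh p) (dhypcosh p i x).
Proof.
rewrite /hyp_space/= => p1 x1.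
have D0 : 1 - sqnorm x != 0 by lra.
have k0 : 1 - sqnorm p != 0 by lra.
apply: is_derive_eq.
  apply: is_derive_add.
  apply: is_derive_mul.
    apply: is_derive_scale; exact: is_derive_sqnormB.
  apply: is_derive_inv; last by rewrite mulf_neq0.
  apply: is_derive_mul.
  exact: is_derive_conf.
by rewrite /dhypcosh; field; rewrite D0 k0.
Qed.

Lemma is_derive_dhypcosh p x i j : hyp_space p -> hyp_space x ->
  is_derive x (delta_mx 0 j) (dhypcosh p i) (ddhypcosh p i j x).
Proof.
rewrite /hyp_space/= => p1 x1.
have D0 : 1 - sqnorm x != 0 by lra.
have k0 : 1 - sqnorm p != 0 by lra.
apply: is_derive_eq.
  apply: is_derive_scale; apply: is_derive_add.
    apply: is_derive_mul.
      apply: is_derive_sub; first exact: is_derive_coord.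
    by apply: is_derive_inv => //; exact: is_derive_conf.
  apply: is_derive_mul.
    apply: is_derive_mul; first exact: is_derive_sqnormB.
    exact: is_derive_coord.
  apply: is_derive_inv; last by rewrite expf_neq0.
  by apply: is_derive_exp; exact: is_derive_conf.
by rewrite /ddhypcosh /=; field; rewrite D0 k0.
Qed.

(** The conformal factor turns the Euclidean gradient into the Riemannian one. For [C = cosh t] the
    identity says that the distance [t] has a gradient of length one. *)
Lemma sum_dhypcosh_sqr p x : hyp_space p -> hyp_space x ->
  (1 - sqnorm x) ^+ 2 / 4 * \sum_(i < n) dhypcosh p i x ^+ 2
  = hypcosh p x ^+ 2 - 1.
Proof.
rewrite /hyp_space/= => p1 x1.
have D0 : 1 - sqnorm x != 0 by lra.
have k0 : 1 - sqnorm p != 0 by lra.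
pose D := 1 - sqnorm x; pose k := 1 - sqnorm p; pose N := sqnorm (x - p).
rewrite (eq_bigr (fun i =>
   (16 / k ^+ 2 * (D^-1 + N / D ^+ 2) ^+ 2) * x 0 i ^+ 2 +
   (- 2 * (16 / k ^+ 2) * (D^-1 + N / D ^+ 2) / D) * (x 0 i * p 0 i) +
   (16 / k ^+ 2 / D ^+ 2) * p 0 i ^+ 2 + 0)); last first.
  by move=> i _; rewrite /dhypcosh -/D -/k -/N; field; rewrite D0 k0.
rewrite sum_quadratic /hypcosh -/N /D /k /N sqnormB.
by field; rewrite D0 k0.
Qed.

(** By [laplacian_hypE] the left side is the Laplacian of [hypcosh p]. On the hyperboloid
    [hypcosh p] is the restriction of a linear function, which explains the eigenvalue [n]. *)
Lemma sum_ddhypcosh p x : hyp_space p -> hyp_space x ->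
  (1 - sqnorm x) ^+ 2 / 4 * \sum_(i < n) (ddhypcosh p i i x +
      (n%:R - 2) * (2 * x 0 i / (1 - sqnorm x)) * dhypcosh p i x)
  = n%:R * hypcosh p x.
Proof.
rewrite /hyp_space/= => p1 x1.
have D0 : 1 - sqnorm x != 0 by lra.
have k0 : 1 - sqnorm p != 0 by lra.
pose D := 1 - sqnorm x; pose k := 1 - sqnorm p; pose N := sqnorm (x - p).
rewrite (eq_bigr (fun i =>
   (4 / k * (4 / D ^+ 2 + 4 * N / D ^+ 3
     + (n%:R - 2) * (2 / D) * (D^-1 + N / D ^+ 2))) * x 0 i ^+ 2 +
   (4 / k * (- 4 / D ^+ 2 - (n%:R - 2) * (2 / D) / D)) * (x 0 i * p 0 i) +
   0 * p 0 i ^+ 2 + 4 / k * (D^-1 + N / D ^+ 2))); last first.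
  by move=> i _; rewrite /dhypcosh /ddhypcosh eqxx mulr1n -/D -/k -/N; field; rewrite D0 k0.
rewrite sum_quadratic /hypcosh -/N /D /k /N sqnormB.
by field; rewrite D0 k0.
Qed.

Section Radial.
Context (p : 'rV[R]_n) (F F1 F2 : R -> R).
Hypothesis hp : hyp_space p.

Lemma partial_radial x i : hyp_space x ->
  is_derive (hypcosh p x) 1 F (F1 (hypcosh p x)) ->
  is_derive x (delta_mx 0 i) (fun y => F (hypcosh p y))
    (F1 (hypcosh p x) * dhypcosh p i x).
Proof. by move=> xU dF; exact: (is_derive_compR (is_derive_hypcosh i hp xU) dF). Qed.

Lemma partial_radialE x i : hyp_space x ->
  (\forall c \near hypcosh p x, is_derive (c : R) 1 F (F1 c)) ->
  \forall y \near x, F1 (hypcosh p y) * dhypcosh p i y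
    = partial i (fun y => F (hypcosh p y)) y.
Proof.
move=> xU dF.
have /= dF' := hypcosh_continuous hp xU dF.
near=> y.
have yU : hyp_space y by near: y; exact: open_nbhs_nbhs (conj hyp_space_open xU).
have dFy : is_derive (hypcosh p y) 1 F (F1 (hypcosh p y)) by near: y.
by rewrite /partial (@derive_val _ _ _ _ _ _ _ (partial_radial i yU dFy)).
Unshelve. all: by end_near. Qed.

Lemma is_derive_partial_radial x i j : hyp_space x ->
  (\forall c \near hypcosh p x, is_derive (c : R) 1 F (F1 c)) ->
  is_derive (hypcosh p x) 1 F1 (F2 (hypcosh p x)) ->
  is_derive x (delta_mx 0 j) (partial i (fun y => F (hypcosh p y)))
    (F1 (hypcosh p x) * ddhypcosh p i j x
     + F2 (hypcosh p x) * dhypcosh p i x * dhypcosh p j x).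
Proof.
move=> xU dF dF1.
apply: near_eq_is_derive (partial_radialE i xU dF) _.
apply: is_derive_eq.
  apply: is_derive_mul; last exact: is_derive_dhypcosh.
  exact: (is_derive_compR (is_derive_hypcosh j hp xU) dF1).
by rewrite /=; ring.
Qed.

(** Chain rule: the Laplacian of [F (C)] is [F2 |grad C|^2 + F1 laplacian C], into which the two
    identities above are substituted. *)
Lemma laplacian_radial x : hyp_space x ->
  (\forall c \near hypcosh p x, is_derive (c : R) 1 F (F1 c)) ->
  is_derive (hypcosh p x) 1 F1 (F2 (hypcosh p x)) ->
  laplacian hyp_metric (fun y => F (hypcosh p y)) x =
  (hypcosh p x ^+ 2 - 1) * F2 (hypcosh p x) + n%:R * hypcosh p x * F1 (hypcosh p x).
Proof.
move=> xU dF dF1.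
have d2 i := is_derive_partial_radial i i xU dF dF1.
rewrite laplacian_hypE//.
rewrite -sum_dhypcosh_sqr// -sum_ddhypcosh//.
rewrite -!mulrA !mulr_suml -!mulrDr -big_split/=; congr (_ * (_ * _)); congr (_ * _).
apply: eq_bigr => i _.
have d1 := nbhs_singleton dF.
rewrite [partial i (partial i _) x](@derive_val _ _ _ _ _ _ _ (d2 i)).
rewrite [partial i _ x](@derive_val _ _ _ _ _ _ _ (partial_radial i xU d1)).
by rewrite /=; ring.
Qed.

End Radial.
End HyperbolicLaplacian.

(** * The hyperbolic distance *)

Section HyperbolicFunctions.
Context {R : realType}.
Implicit Types x y h e : R.

Definition cosh x : R := (expR x + expR (- x)) / 2.

Lemma cosh2Bsinh2 x : cosh x ^+ 2 - sinh x ^+ 2 = 1.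
Proof.
have e : expR x * expR (- x) = 1 by rewrite -expRD subrr expR0.
transitivity (expR x * expR (- x)); last exact: e.
by rewrite /cosh /sinh; field.
Qed.

Lemma is_derive_cosh x : is_derive x 1 cosh (sinh x).
Proof.
rewrite [cosh]/cosh; apply: is_derive_eq.
by rewrite /sinh /GRing.scale/=; field.
Qed.

Lemma is_derive_sinh x : is_derive x 1 sinh (cosh x).
Proof.
rewrite [sinh]/sinh; apply: is_derive_eq.
by rewrite /cosh /GRing.scale/=; field.
Qed.

Lemma sinh0 : sinh 0 = 0 :> R.
Proof. by rewrite /sinh oppr0 subrr mul0r. Qed.

Lemma cosh0 : cosh 0 = 1 :> R.
Proof. by rewrite /cosh oppr0 expR0; field. Qed.

Lemma cosh_gt_sinh x : sinh x < cosh x.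
Proof. by rewrite /cosh /sinh; have := expR_gt0 (- x); lra. Qed.

Lemma cosh_gt_Nsinh x : - sinh x < cosh x.
Proof. by rewrite /cosh /sinh; have := expR_gt0 x; lra. Qed.

Lemma cosh_gt0 x : 0 < cosh x.
Proof. by rewrite /cosh; have := expR_gt0 x; have := expR_gt0 (- x); lra. Qed.

Lemma ltr_sinh x y : x < y -> sinh x < sinh y.
Proof.
move=> xy; rewrite /sinh.
have : expR x < expR y by rewrite ltr_expR.
have : expR (- y) < expR (- x) by rewrite ltr_expR ltrN2.
lra.
Qed.

Lemma sinh_gt0 x : 0 < x -> 0 < sinh x.
Proof. by rewrite -{2}sinh0; exact: ltr_sinh. Qed.

Lemma sinh_ge0 x : 0 <= x -> 0 <= sinh x.
Proof. by rewrite le_eqVlt => /predU1P[<-|/sinh_gt0/ltW//]; rewrite sinh0. Qed.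

Lemma cosh_ge1 x : 1 <= cosh x.
Proof.
have := cosh2Bsinh2 x; have := cosh_gt0 x; have := sqr_ge0 (sinh x).
set s := _ ^+ 2; nra.
Qed.

Lemma ltr_cosh x y : 0 <= x -> x < y -> cosh x < cosh y.
Proof.
move=> x0 xy; have sx := sinh_ge0 x0; have sxy := ltr_sinh xy.
have := cosh2Bsinh2 x; have := cosh2Bsinh2 y.
have := cosh_gt0 x; have := cosh_gt0 y.
have : sinh x ^+ 2 < sinh y ^+ 2 by nra.
nra.
Qed.

Lemma ler_cosh x y : 0 <= x -> x <= y -> cosh x <= cosh y.
Proof.
by move=> x0; rewrite le_eqVlt => /predU1P[->//|/(ltr_cosh x0)/ltW].
Qed.

Lemma ge_sinh x : 0 <= x -> x <= sinh x.
Proof.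
move=> x0; rewrite -subr_ge0.
have := @nondecreasing_of_is_derive R (fun y => sinh y - y) (fun y => cosh y - 1) 0 x
  (fun y _ => is_derive_sub (is_derive_sinh y) (is_derive_id y 1)) _ 0 x (lexx 0) x0 (lexx x).
rewrite sinh0 subrr; apply => y _.
by rewrite subr_ge0 cosh_ge1.
Qed.

Definition arcosh h : R := ln (h + Num.sqrt (h ^+ 2 - 1)).

Lemma cosh_ln x : 0 < x -> cosh (ln x) = (x + x^-1) / 2.
Proof. by move=> x0; rewrite /cosh expRN lnK. Qed.

Lemma arcosh_ge0 h : 1 <= h -> 0 <= arcosh h.
Proof. by move=> h1; rewrite ln_ge0// (le_trans h1)// lerDl sqrtr_ge0. Qed.

Lemma arcoshK h : 1 <= h -> cosh (arcosh h) = h.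
Proof.
move=> h1; have s0 := sqrtr_ge0 (h ^+ 2 - 1).
have s2 : Num.sqrt (h ^+ 2 - 1) ^+ 2 = h ^+ 2 - 1.
  by rewrite sqr_sqrtr// subr_ge0; nra.
rewrite cosh_ln; last by lra.
have E0 : h + Num.sqrt (h ^+ 2 - 1) != 0 by lra.
apply: (mulIf E0).
set s := Num.sqrt _ in s0 s2 E0 *.
have -> : (h + s + (h + s)^-1) / 2 = ((h + s) ^+ 2 + 1) / 2 / (h + s) by field.
rewrite divfK//; nra.
Qed.

Lemma coshK x : 0 <= x -> arcosh (cosh x) = x.
Proof.
move=> x0; rewrite /arcosh.
have -> : cosh x ^+ 2 - 1 = sinh x ^+ 2 by have := cosh2Bsinh2 x; lra.
rewrite sqrtr_sqr ger0_norm ?sinh_ge0//.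
have -> : cosh x + sinh x = expR x by rewrite /cosh /sinh; field.
by rewrite expRK.
Qed.

Lemma ltr_arcosh h x : 1 <= h -> 0 <= x -> h < cosh x -> arcosh h < x.
Proof.
move=> h1 x0; apply: contraTT; rewrite -!leNgt => xa.
by rewrite -(arcoshK h1) ler_cosh.
Qed.

(* [arcosh] is not differentiable at 1, where every path from [p] starts; the
   length estimate is proved with this regularisation, letting [e] tend to 0. *)
Lemma is_derive_regularized_arcosh e h : 0 < h -> 0 < h ^+ 2 - 1 + e ->
  is_derive h 1 (fun z => ln (z + Num.sqrt (z ^+ 2 - 1 + e)))
    (Num.sqrt (h ^+ 2 - 1 + e))^-1.
Proof.
move=> h0 q0.
have s0 : 0 < Num.sqrt (h ^+ 2 - 1 + e) by rewrite sqrtr_gt0.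
have dq := is_derive_add (is_derive_sub (is_derive_exp 2 (is_derive_id h 1))
  (is_derive_const 1 h 1)) (is_derive_const e h 1).
have ds := @is_derive_compR R R (fun z => z ^+ 2 - 1 + e) Num.sqrt h 1 _ _
  dq (is_derive1_sqrt q0).
have l0 : 0 < h + Num.sqrt (h ^+ 2 - 1 + e) by rewrite addr_gt0.
apply: (is_derive_val (@is_derive_compR R R
  (fun z => z + Num.sqrt (z ^+ 2 - 1 + e)) (@ln R) h 1 _ _ (is_derive_add (is_derive_id h 1) ds)
  (is_derive1_ln l0))).
by rewrite /=; field; rewrite !lt0r_neq0.
Qed.

Lemma arcosh_gt0 h : 1 < h -> 0 < arcosh h.
Proof. by move=> h1; rewrite ln_gt0// (lt_le_trans h1)// lerDl sqrtr_ge0. Qed.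

Lemma sinh_arcosh h : 1 <= h -> sinh (arcosh h) = Num.sqrt (h ^+ 2 - 1).
Proof.
move=> h1; have := cosh2Bsinh2 (arcosh h); rewrite arcoshK// => e.
have -> : h ^+ 2 - 1 = sinh (arcosh h) ^+ 2 by lra.
by rewrite sqrtr_sqr ger0_norm// sinh_ge0// arcosh_ge0.
Qed.

Lemma is_derive_arcosh h : 1 < h -> is_derive h 1 arcosh (sinh (arcosh h))^-1.
Proof.
move=> h1; have h0 : 0 < h := lt_trans ltr01 h1.
have q0 : 0 < h ^+ 2 - 1 + 0 by nra.
have := is_derive_regularized_arcosh h0 q0; rewrite sinh_arcosh ?ltW// addr0.
by under eq_fun do rewrite addr0.
Qed.

(** The case [h = 1] is included: it gives continuity of the distance at the centre of the ball. *)
Lemma arcosh_continuous h : 1 <= h -> {for h, continuous arcosh}.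
Proof.
move=> h1; have cid : {for h, continuous (fun z : R => z)} by exact: cvg_id.
have cs : {for h, continuous (fun z : R => z + Num.sqrt (z ^+ 2 - 1))}.
  apply: continuous_at_add => //.
  apply: (@continuous_comp _ _ _ (fun z : R => z ^+ 2 - 1) Num.sqrt).
    apply: continuous_at_sub; last exact: continuous_at_const.
    exact: continuous_at_exp.
  exact: sqrt_continuous.
apply: (@continuous_comp _ _ _ (fun z : R => z + Num.sqrt (z ^+ 2 - 1)) (@ln R)) => //.
by apply: continuous_ln; rewrite ltr_pwDl ?sqrtr_ge0// (lt_le_trans ltr01).
Qed.

End HyperbolicFunctions.

(** * Lower bound for the length of paths *)

Section IncrementIntegral.
Context {R : realType}.

(** Applied with [s] the hyperbolic speed of a path and [k] a regularised distance from [p] along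
    it. *)
Lemma increment_le_integral (k k1 s : R -> R) :
  (forall t : R, 0 <= t <= 1 -> is_derive (t : R) 1 k (k1 t)) ->
  (forall t : R, 0 <= t <= 1 -> {for t, continuous k1}) ->
  (forall t : R, 0 <= t <= 1 -> {for t, continuous s}) ->
  (forall t : R, 0 <= t <= 1 -> k1 t <= s t) ->
  ((k 1 - k 0)%:E <= \int[lebesgue_measure]_(t in `[0%R : R, 1%R]) (s t)%:E)%E.
Proof.
move=> dk ck cs ks.
have wc (f : R -> R) : (forall t : R, 0 <= t <= 1 -> {for t, continuous f}) ->
    {within `[(0 : R), 1], continuous f}.
  move=> cf; apply: continuous_in_subspaceT => t.
  by rewrite inE/= in_itv/= => /cf.
have c01 : forall t : R, t \in `]0, 1[ -> 0 <= t <= 1.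
  by move=> t; rewrite in_itv/= => /andP[/ltW -> /ltW ->].
have <- : (\int[lebesgue_measure]_(t in `[0%R : R, 1%R]) (k1 t)%:E = (k 1 - k 0)%:E)%E.
  rewrite EFinB; apply: continuous_FTC2 => //; first exact: wc.
    split.
    - by move=> t /c01/dk[].
    - apply: cvg_at_right_filter; apply: (@is_derive_continuous _ _ _ (k1 0)).
      by apply: dk; rewrite lexx ler01.
    - apply: cvg_at_left_filter; apply: (@is_derive_continuous _ _ _ (k1 1)).
      by apply: dk; rewrite lexx ler01.
  by move=> t /c01/dk[_]; rewrite derive1E.
apply: le_integral.
- exact: measurable_itv.
- by apply: continuous_compact_integrable; [exact: segment_compact|exact: wc].
- by apply: continuous_compact_integrable; [exact: segment_compact|exact: wc].
- by move=> t; rewrite inE/= in_itv/= => /ks; rewrite lee_fin.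
Qed.

End IncrementIntegral.

Section HyperbolicDistance.
Context {R : realType} {n : nat}.
Implicit Types (x y p v : 'rV[R]_n) (c : R -> 'rV[R]_n).

(** The sum of the squares [(a i B - b i P)^2] equals [B (A B - P^2)]; the factor [B] is cancelled,
    which is why [B = 0] is treated apart. *)
Lemma sum_cauchy_schwarz (a b : 'I_n -> R) :
  (\sum_(i < n) a i * b i) ^+ 2 <= (\sum_(i < n) a i ^+ 2) * (\sum_(i < n) b i ^+ 2).
Proof.
set P := \sum_(i < n) a i * b i; set A := \sum_(i < n) a i ^+ 2.
set B := \sum_(i < n) b i ^+ 2.
have B0 : 0 <= B by apply: sumr_ge0 => i _; exact: sqr_ge0.
have [Bz|Bn0] := eqVneq B 0.
  have b0 i : b i = 0.
    move/eqP: Bz; rewrite psumr_eq0; last by move=> j _; exact: sqr_ge0.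
    move=> /allP /(_ i (mem_index_enum _)).
    by rewrite sqrf_eq0 => /eqP.
  rewrite /P big1 ?expr0n ?Bz ?mulr0// => i _.
  by rewrite b0 mulr0.
have Bgt : 0 < B by rewrite lt_def Bn0.
have : 0 <= B * (A * B - P ^+ 2).
  have <- : \sum_(i < n) (a i * B - b i * P) ^+ 2 = B * (A * B - P ^+ 2).
    rewrite (eq_bigr (fun i => B ^+ 2 * a i ^+ 2 + (- 2 * B * P) * (a i * b i)
      + P ^+ 2 * b i ^+ 2)); last by move=> i _; ring.
    by rewrite !big_split/= -!mulr_sumr -/A -/B -/P; ring.
  by apply: sumr_ge0 => i _; exact: sqr_ge0.
by rewrite pmulr_rge0// subr_ge0.
Qed.

Lemma riem_norm_hyp x v : hyp_space x ->
  riem_norm hyp_metric x v = 2 / (1 - sqnorm x) * Num.sqrt (sqnorm v).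
Proof.
rewrite /hyp_space/= => x1; rewrite /riem_norm /hyp_metric mul_mx_scalar.
rewrite -scalemxAl !mxE.
have -> : \sum_j v 0 j * v^T j 0 = sqnorm v.
  by apply: eq_bigr => j _; rewrite mxE expr2.
have -> : 4 / (1 - sqnorm x) ^+ 2 = (2 / (1 - sqnorm x)) ^+ 2 by field; lra.
rewrite sqrtrM ?sqr_ge0// sqrtr_sqr ger0_norm// divr_ge0//; lra.
Qed.

Lemma is_derive_path_coord c t i : derivable c t 1 ->
  is_derive t 1 (fun s => c s 0 i) (derive1 c t 0 i).
Proof.
move=> dc; split; first by move/derivable_mxP : dc => /(_ 0 i).
have := derive_mx dc; rewrite derive1E => /matrixP /(_ 0 i).
by rewrite !mxE => ->.
Qed.

Lemma is_derive_sqnorm_path c t p : derivable c t 1 ->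
  is_derive t 1 (fun s => sqnorm (c s - p))
    (\sum_(i < n) 2 * (c t 0 i - p 0 i) * derive1 c t 0 i).
Proof.
move=> dc.
have e : (fun s => sqnorm (c s - p)) = fun s => \sum_(i < n) (c s 0 i - p 0 i) ^+ 2.
  by apply/funext => s; apply: eq_bigr => i _; rewrite !mxE.
rewrite e; apply: is_derive_bigsum => i.
apply: is_derive_eq.
  apply: is_derive_exp; apply: is_derive_sub; exact: is_derive_path_coord.
by rewrite /= subr0 expr1.
Qed.

(** Computed from the coordinates of the path, because for [hypcosh] itself only derivatives along
    the axes have been established. *)
Lemma is_derive_hypcosh_path c t p : derivable c t 1 -> hyp_space p ->
  hyp_space (c t) ->
  is_derive t 1 (fun s => hypcosh p (c s))
    (\sum_(i < n) dhypcosh p i (c t) * derive1 c t 0 i).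
Proof.
rewrite /hyp_space/= => dc p1 c1.
have D0 : 1 - sqnorm (c t) != 0 by lra.
have k0 : 1 - sqnorm p != 0 by lra.
have dD : is_derive t 1 (fun s => 1 - sqnorm (c s))
    (0 - \sum_(i < n) 2 * (c t 0 i - (0 : 'rV[R]_n) 0 i) * derive1 c t 0 i).
  apply: is_derive_sub.
  have -> : (fun s => sqnorm (c s)) = fun s => sqnorm (c s - 0).
    by apply/funext => s; rewrite subr0.
  exact: is_derive_sqnorm_path.
have d1 := is_derive_scale 2 (is_derive_sqnorm_path p dc).
have d2 := is_derive_mul dD (is_derive_const (1 - sqnorm p) t 1).
have d3 := is_derive_inv d2 (mulf_neq0 D0 k0).
apply: (is_derive_val (is_derive_add (is_derive_const 1 t 1) (is_derive_mul d1 d3))).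
have -> : \sum_(i < n) 2 * (c t 0 i - (0 : 'rV[R]_n) 0 i) * derive1 c t 0 i
   = \sum_(i < n) 2 * c t 0 i * derive1 c t 0 i.
  by apply: eq_bigr => i _; rewrite mxE subr0.
have -> : \sum_(i < n) dhypcosh p i (c t) * derive1 c t 0 i =
    2 / ((1 - sqnorm p) * (1 - sqnorm (c t)))
      * (\sum_(i < n) 2 * (c t 0 i - p 0 i) * derive1 c t 0 i)
    + 2 * sqnorm (c t - p) / ((1 - sqnorm p) * (1 - sqnorm (c t)) ^+ 2)
      * (\sum_(i < n) 2 * c t 0 i * derive1 c t 0 i).
  rewrite !mulr_sumr -big_split/=; apply: eq_bigr => i _.
  by rewrite -mulr_sumr -/(sqnorm (c t - p)) /dhypcosh; field; rewrite D0 k0.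
by rewrite /=; field; rewrite D0 k0.
Qed.

Lemma path_coord_continuous c t i : {for t, continuous c} ->
  {for t, continuous (fun s => c s 0 i)}.
Proof.
move=> cc; apply: (@continuous_comp _ _ _ c (fun M : 'rV[R]_n => M 0 i)) => //.
exact: coord_continuous.
Qed.

Lemma sqnorm_path_continuous c t : {for t, continuous c} ->
  {for t, continuous (fun s => sqnorm (c s))}.
Proof.
move=> cc; apply: (@continuous_comp _ _ _ c (@sqnorm R n)) => //.
have -> : @sqnorm R n = fun y => sqnorm (y - 0) by apply/funext => y; rewrite subr0.
exact: sqnorm_continuous.
Qed.

(** By Cauchy-Schwarz and the gradient identity, [|C'|] is at most [sqrt (C^2 - 1)] times the speed
    [s]. The regularised [arcosh] has the smaller derivative [1 / sqrt (C^2 - 1 + e)], so along the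
    path it grows no faster than arc length. *)
Lemma riem_length_hyp_ge p x c : hyp_space p -> C1_path hyp_space p x c ->
  ((arcosh (hypcosh p x))%:E <= riem_length hyp_metric c)%E.
Proof.
move=> hp [dc cdc cU c0 c1].
have C0e : hypcosh p (c 0) = 1 by rewrite c0 hypcoshxx.
have C1e : hypcosh p (c 1) = hypcosh p x by rewrite c1.
clear c0 c1.
pose s t := 2 / (1 - sqnorm (c t)) * Num.sqrt (sqnorm (derive1 c t)).
have cU' t : 0 <= t <= 1 -> hyp_space (c t).
  by move=> t01; apply: cU; rewrite in_itv.
have -> : riem_length hyp_metric c = (\int[lebesgue_measure]_(t in `[0%R : R, 1%R]) (s t)%:E)%E.
  apply: eq_integral => t; rewrite inE/= in_itv/= => t01.
  by rewrite riem_norm_hyp//; exact: cU'.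
pose C t := hypcosh p (c t).
pose C' t := \sum_(i < n) dhypcosh p i (c t) * derive1 c t 0 i.
have cc t : {for t, continuous c}.
  by apply/differentiable_continuous/derivable1_diffP.
have cs t : 0 <= t <= 1 -> {for t, continuous s}.
  move=> /cU'; rewrite /hyp_space/= => ct1; apply: continuous_at_mul.
    apply: continuous_at_mul; first exact: continuous_at_const.
    apply: continuous_at_inv; first by lra.
    apply: continuous_at_sub; first exact: continuous_at_const.
    exact: sqnorm_path_continuous.
  apply: (@continuous_comp _ _ _ (fun t => sqnorm (derive1 c t)) Num.sqrt).
    by apply: sqnorm_path_continuous; exact: cdc.
  exact: sqrt_continuous.
have C1 t : 0 <= t <= 1 -> 1 <= C t by move=> /cU'; exact: hypcosh_ge1.
have cC t : 0 <= t <= 1 -> {for t, continuous C}.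
  move=> t01; apply: (@continuous_comp _ _ _ c (hypcosh p)); first exact: cc.
  by apply: hypcosh_continuous => //; exact: cU'.
have cC' t : 0 <= t <= 1 -> {for t, continuous C'}.
  move=> t01.
  apply: continuous_at_sum => i.
  apply: continuous_at_mul; last exact: path_coord_continuous (cdc t).
  apply: (@continuous_comp _ _ _ c (dhypcosh p i)); first exact: cc.
  by apply: dhypcosh_continuous => //; exact: cU'.
have bound e : 0 < e ->
    ((ln (C 1 + Num.sqrt (C 1 ^+ 2 - 1 + e)) - ln (C 0 + Num.sqrt (C 0 ^+ 2 - 1 + e)))%:E
     <= \int[lebesgue_measure]_(t in `[0%R : R, 1%R]) (s t)%:E)%E.
  move=> e0.
  have q0 t : 0 <= t <= 1 -> 0 < C t ^+ 2 - 1 + e by move=> /C1; nra.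
  apply: (@increment_le_integral R
    (fun t => ln (C t + Num.sqrt (C t ^+ 2 - 1 + e)))
    (fun t => (Num.sqrt (C t ^+ 2 - 1 + e))^-1 * C' t)) => //.
  - move=> t t01.
    apply: (@is_derive_compR _ _ C (fun z => ln (z + Num.sqrt (z ^+ 2 - 1 + e)))).
      by apply: is_derive_hypcosh_path => //; exact: cU'.
    by apply: is_derive_regularized_arcosh; [exact: lt_le_trans ltr01 (C1 _ t01)|exact: q0].
  - move=> t t01; apply: continuous_at_mul; last exact: cC'.
    apply: continuous_at_inv; first by rewrite gt_eqF// sqrtr_gt0 q0.
    apply: (@continuous_comp _ _ _ (fun t => C t ^+ 2 - 1 + e) Num.sqrt).
      apply: continuous_at_add; last exact: continuous_at_const.
      apply: continuous_at_sub; last exact: continuous_at_const.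
      by apply: continuous_at_exp; exact: cC.
    exact: sqrt_continuous.
  - move=> t t01; rewrite mulrC ler_pdivrMr ?sqrtr_gt0 ?q0//.
    have ct1 : sqnorm (c t) < 1 by exact: cU'.
    have s0 : 0 <= s t.
      rewrite /s mulr_ge0 ?sqrtr_ge0// divr_ge0//; lra.
    have CS := sum_cauchy_schwarz (fun i => dhypcosh p i (c t)) (fun i => derive1 c t 0 i).
    have grad := sum_dhypcosh_sqr hp (cU' _ t01).
    have := le_trans (ler_norm _) (_ : `|C' t| <= s t * Num.sqrt (C t ^+ 2 - 1 + e)).
    apply; have sC0 := mulr_ge0 s0 (sqrtr_ge0 (C t ^+ 2 - 1 + e)).
    rewrite -(@ler_pXn2r _ 2)//.
    rewrite real_normK ?num_real// exprMn sqr_sqrtr ?(ltW (q0 _ t01))//.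
    have es : s t ^+ 2 = 4 / (1 - sqnorm (c t)) ^+ 2 * sqnorm (derive1 c t).
      by rewrite /s exprMn sqr_sqrtr ?sqnorm_ge0//; field; lra.
    apply: (le_trans CS); rewrite -/(sqnorm (derive1 c t)).
    have -> : \sum_(i < n) dhypcosh p i (c t) ^+ 2
        = 4 / (1 - sqnorm (c t)) ^+ 2 * (C t ^+ 2 - 1).
      by rewrite /C -grad; field; lra.
    rewrite mulrAC -es; apply: ler_wpM2l; first exact: sqr_ge0.
    by rewrite lerDl ltW.
have C11 : 1 <= C 1 by apply: C1; rewrite lexx ler01.
rewrite -C1e -/(C 1); apply/lee_addgt0Pr => d d0.
(* [e] is such that [ln (1 + sqrt e) = d]. *)
pose e := (expR d - 1) ^+ 2.
have ed : 0 < expR d - 1 by rewrite subr_gt0 expR_gt1.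
have e0 : 0 < e by rewrite exprn_gt0.
apply: le_trans (leeD2r d%:E (bound e e0)).
rewrite -EFinD lee_fin [C 0]C0e expr1n subrr add0r sqrtr_sqr gtr0_norm//.
have -> : 1 + (expR d - 1) = expR d by ring.
rewrite expRK subrK /arcosh.
have a0 : 0 < C 1 + Num.sqrt (C 1 ^+ 2 - 1).
  by rewrite ltr_pwDl ?sqrtr_ge0//; lra.
have ab : C 1 + Num.sqrt (C 1 ^+ 2 - 1) <= C 1 + Num.sqrt (C 1 ^+ 2 - 1 + e).
  by rewrite lerD2l ler_wsqrtr// lerDl ltW.
by rewrite ler_ln ?posrE// (lt_le_trans a0).
Qed.

End HyperbolicDistance.

(** * Hyperboloid geodesics and the distance formula *)

Section Geodesic.
Context {R : realType} {n : nat}.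

Lemma sqnorm_lin (A T : 'rV[R]_n) (a b : R) :
  sqnorm (a *: A + b *: T)
  = a ^+ 2 * sqnorm A + 2 * a * b * dotv A T + b ^+ 2 * sqnorm T.
Proof.
have := sum_quadratic A T (a ^+ 2) (2 * a * b) (b ^+ 2) 0.
by rewrite mulr0 addr0 => <-; apply: eq_bigr => i _; rewrite !mxE; ring.
Qed.

Lemma is_derive_path (c c' : R -> 'rV[R]_n) :
  (forall t i, is_derive (t : R) 1 (fun s => c s 0 i) (c' t 0 i)) ->
  (forall t : R, derivable c t 1) /\ derive1 c = c'.
Proof.
move=> dc.
have D (t : R) : derivable c t 1.
  apply/derivable_mxP => i j; rewrite (ord1 i).
  by case: (dc t j).
split => //; apply/funext => t; rewrite derive1E derive_mx//.
apply/rowP => i; rewrite mxE.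
exact: (@derive_val _ _ _ _ _ _ _ (dc t i)).
Qed.

(* [(P0, A)] and [(T0, T)] are a point of the hyperboloid and a unit tangent
   vector there; the path is the projection to the ball of the geodesic
   [cosh (t d) (P0, A) + sinh (t d) (T0, T)]. *)
Section Hyperboloid.
Context (A T : 'rV[R]_n) (P0 T0 d : R).
Hypotheses (P01 : 1 <= P0) (AA : sqnorm A = P0 ^+ 2 - 1)
  (AT : dotv A T = P0 * T0) (TT : sqnorm T = 1 + T0 ^+ 2).

(** The hyperboloid point [(X0, X)] projects to [X / (1 + X0)] in the ball; this is that denominator
    along the geodesic. Its derivative in [t] is [d] times [geod_den']. *)
Definition geod_den (t : R) : R := 1 + (cosh (t * d) * P0 + sinh (t * d) * T0).

Definition geod_den' (t : R) : R := sinh (t * d) * P0 + cosh (t * d) * T0.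

Definition geod (t : R) : 'rV[R]_n :=
  (geod_den t)^-1 *: (cosh (t * d) *: A + sinh (t * d) *: T).

Definition geod' (t : R) : 'rV[R]_n := (d / geod_den t) *:
  ((sinh (t * d) - cosh (t * d) * geod_den' t / geod_den t) *: A
   + (cosh (t * d) - sinh (t * d) * geod_den' t / geod_den t) *: T).

(** Cauchy-Schwarz on [A], [T] gives [T0^2 <= P0^2 - 1], hence [|T0| < P0]. Twice
    [cosh P0 + sinh T0] is [(cosh - sinh)(P0 - T0) + (cosh + sinh)(P0 + T0)], a sum of positive
    products. *)
Lemma geod_den_gt0 t : 0 < geod_den t.
Proof.
have T0P : `|T0| < P0.
  have cs : (P0 * T0) ^+ 2 <= (P0 ^+ 2 - 1) * (1 + T0 ^+ 2).
    rewrite -AT -AA -TT.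
    exact: (sum_cauchy_schwarz (fun i => A 0 i) (fun i => T 0 i)).
  have h : T0 ^+ 2 < P0 ^+ 2 by nra.
  have P00 : 0 <= P0 := le_trans ler01 P01.
  by rewrite -(@ltr_pXn2r _ 2)// ?nnegrE ?normr_ge0// real_normK ?num_real.
move: T0P; rewrite ltr_norml => /andP[T1 T2]; rewrite /geod_den.
have h1 : 0 < (cosh (t * d) - sinh (t * d)) * (P0 - T0).
  by rewrite mulr_gt0 ?subr_gt0// cosh_gt_sinh.
have h2 : 0 < (cosh (t * d) + sinh (t * d)) * (P0 + T0).
  rewrite mulr_gt0//; first by rewrite -ltrBlDr sub0r cosh_gt_Nsinh.
  by rewrite -ltrBlDl sub0r.
nra.
Qed.

Let w0 t : geod_den t != 0. Proof. exact: lt0r_neq0 (geod_den_gt0 t). Qed.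

(** On the hyperboloid [|X|^2 = X0^2 - 1], so [|X|^2 / (1 + X0)^2 = (X0 - 1) / (X0 + 1)]. *)
Lemma sqnorm_geod t : sqnorm (geod t) = 1 - 2 / geod_den t.
Proof.
have h := cosh2Bsinh2 (t * d).
have -> : geod t = (cosh (t * d) / geod_den t) *: A + (sinh (t * d) / geod_den t) *: T.
  by rewrite /geod scalerDr !scalerA ![_^-1 * _]mulrC.
have -> : 1 - 2 / geod_den t = ((geod_den t - 1) ^+ 2 - 1) / geod_den t ^+ 2.
  by field; exact: w0.
rewrite sqnorm_lin AA AT TT.
transitivity ((cosh (t * d) ^+ 2 * (P0 ^+ 2 - 1) + 2 * cosh (t * d) * sinh (t * d)
    * (P0 * T0) + sinh (t * d) ^+ 2 * (1 + T0 ^+ 2)) / geod_den t ^+ 2).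
  by field; exact: w0.
have -> : (geod_den t - 1) ^+ 2 - 1 = (cosh (t * d) * P0 + sinh (t * d) * T0) ^+ 2
    - (cosh (t * d) ^+ 2 - sinh (t * d) ^+ 2) by rewrite h /geod_den; ring.
by congr (_ / _); ring.
Qed.

(** By [sqnorm_geod] the conformal factor [2 / (1 - |x|^2)] is [geod_den t], so this makes the
    hyperbolic speed constant, equal to [|d|]. *)
Lemma sqnorm_geod' t : sqnorm (geod' t) = (d / geod_den t) ^+ 2.
Proof.
have h := cosh2Bsinh2 (t * d).
pose k := geod_den' t / geod_den t.
have -> : geod' t = (d / geod_den t * (sinh (t * d) - cosh (t * d) * k)) *: A
    + (d / geod_den t * (cosh (t * d) - sinh (t * d) * k)) *: T.
  by rewrite /geod' scalerDr !scalerA /k !mulrA.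
rewrite sqnorm_lin AA AT TT.
set c := cosh (t * d) in h *; set s := sinh (t * d) in h *.
have ew : geod_den t = 1 + (c * P0 + s * T0) by [].
have ew' : geod_den' t = s * P0 + c * T0 by [].
have kw : k * geod_den t = geod_den' t by rewrite divfK.
(* Since [k geod_den t = geod_den' t], the last square is [k^2], and the bracket becomes
   [(1 - k^2) + k^2 = 1]. *)
transitivity ((d / geod_den t) ^+ 2 *
    ((c ^+ 2 - s ^+ 2) * (1 - k ^+ 2)
     + (geod_den' t - k * (geod_den t - 1)) ^+ 2)).
  by rewrite ew ew'; ring.
rewrite h mul1r mulrBr mulr1 kw opprB addrCA subrr addr0.
by rewrite subrK mulr1.
Qed.

Lemma is_derive_geod (t : R) i : is_derive t 1 (fun s => geod s 0 i) (geod' t 0 i).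
Proof.
have dtd : is_derive t 1 (fun s : R => s * d) d.
  apply: (is_derive_val (is_derive_mul (is_derive_id t 1) (is_derive_const d t 1))).
  by rewrite mulr0 add0r mulr1.
have dc := is_derive_compR dtd (is_derive_cosh (t * d)).
have ds := is_derive_compR dtd (is_derive_sinh (t * d)).
have dw : is_derive t 1 geod_den (d * geod_den' t).
  apply: (is_derive_val (is_derive_add (is_derive_const 1 t 1) (is_derive_add
    (is_derive_mul dc (is_derive_const P0 t 1))
    (is_derive_mul ds (is_derive_const T0 t 1))))).
  by rewrite /geod_den'; ring.
have dn := is_derive_add (is_derive_mul dc (is_derive_const (A 0 i) t 1))
  (is_derive_mul ds (is_derive_const (T 0 i) t 1)).
have e : (fun s => geod s 0 i) = fun s => (geod_den s)^-1 *
    (cosh (s * d) * A 0 i + sinh (s * d) * T 0 i).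
  by apply/funext => s; rewrite /geod !mxE.
rewrite e; apply: (is_derive_val (is_derive_mul (is_derive_inv dw (w0 t)) dn)).
by rewrite /geod' !mxE /=; field; exact: w0.
Qed.

Lemma geod_C1_path : C1_path hyp_space (geod 0) (geod 1) geod.
Proof.
have [D E] := is_derive_path is_derive_geod.
split; [exact: D| | |reflexivity|reflexivity].
- rewrite E => t; apply/differentiable_continuous/derivable1_diffP.
  apply/derivable_mxP => k i; rewrite (ord1 k).
  have dtd : is_derive t 1 (fun s : R => s * d) d.
    apply: (is_derive_val (is_derive_mul (is_derive_id t 1) (is_derive_const d t 1))).
    by rewrite mulr0 add0r mulr1.
  have dc := is_derive_compR dtd (is_derive_cosh (t * d)).
  have ds := is_derive_compR dtd (is_derive_sinh (t * d)).
  have dw := is_derive_add (is_derive_const 1 t 1) (is_derive_add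
    (is_derive_mul dc (is_derive_const P0 t 1))
    (is_derive_mul ds (is_derive_const T0 t 1))).
  have dw' := is_derive_add
    (is_derive_mul ds (is_derive_const P0 t 1))
    (is_derive_mul dc (is_derive_const T0 t 1)).
  have di := is_derive_inv dw (w0 t).
  have da := is_derive_sub ds (is_derive_mul (is_derive_mul dc dw') di).
  have db := is_derive_sub dc (is_derive_mul (is_derive_mul ds dw') di).
  have [dg _] := is_derive_mul (is_derive_mul (is_derive_const d t 1) di)
    (is_derive_add (is_derive_mul da (is_derive_const (A 0 i) t 1))
       (is_derive_mul db (is_derive_const (T 0 i) t 1))).
  rewrite [X in derivable X](_ : _ = (fun s => d * (geod_den s)^-1 *
    ((sinh (s * d) - cosh (s * d) * geod_den' s * (geod_den s)^-1) * A 0 i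
    + (cosh (s * d) - sinh (s * d) * geod_den' s * (geod_den s)^-1) * T 0 i))).
    exact: dg.
  by apply/funext => s; rewrite /geod' !mxE.
- move=> t _; rewrite /hyp_space/= sqnorm_geod.
  by rewrite ltrBlDr ltrDl divr_gt0// geod_den_gt0.
Qed.

Lemma riem_length_geod : 0 <= d -> riem_length hyp_metric geod = d%:E.
Proof.
move=> d0; have [_ E] := is_derive_path is_derive_geod.
rewrite /riem_length.
rewrite (eq_integral (cst d%:E)); last first.
  move=> t _; rewrite E riem_norm_hyp; last first.
    by rewrite /hyp_space/= sqnorm_geod ltrBlDr ltrDl divr_gt0// geod_den_gt0.
  rewrite sqnorm_geod' sqnorm_geod sqrtr_sqr ger0_norm; last first.
    by rewrite divr_ge0// ltW// geod_den_gt0.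
  have -> : 1 - (1 - 2 / geod_den t) = 2 / geod_den t by ring.
  by congr EFin; field; exact: w0.
rewrite integral_cst// [X in (_ * X)%E](_ : _ = 1%E) ?mule1//.
have /= := @lebesgue_measure_itv R `[0%R, 1%R].
by rewrite lte_fin ltr01 oppr0 adde0.
Qed.

End Hyperboloid.

Lemma riem_dist_hyp (p x : 'rV[R]_n) : hyp_space p -> hyp_space x ->
  riem_dist hyp_space hyp_metric p x = (arcosh (hypcosh p x))%:E.
Proof.
move=> hp hx; apply/eqP; rewrite eq_le; apply/andP; split; last first.
  apply/ereal_infP => _ [c cP <-].
  exact: riem_length_hyp_ge.
apply: ereal_inf_lbound => /=.
have C1 := hypcosh_ge1 hp hx; have d0 := arcosh_ge0 C1.
set d := arcosh _ in d0 *; have Cd : cosh d = hypcosh p x by exact: arcoshK.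
have p1 : sqnorm p < 1 := hp; have x1 : sqnorm x < 1 := hx.
have k0 : 1 - sqnorm p != 0 by rewrite subr_eq0 gt_eqF.
have D0 : 1 - sqnorm x != 0 by rewrite subr_eq0 gt_eqF.
(* For [x = p] there is no direction to normalise, as [sinh d = 0]; the constant path has length
   0. *)
have [xp|xp] := eqVneq x p.
  exists (cst p); last first.
    rewrite /d xp hypcoshxx /arcosh expr1n subrr sqrtr0 addr0 ln1.
    rewrite /riem_length (eq_integral (cst 0%E)) ?integral0// => t _.
    rewrite riem_norm_hyp// derive1_cst.
    by rewrite [X in Num.sqrt X](_ : _ = 0) ?sqrtr0 ?mulr0// /sqnorm big1// => i _;
      rewrite mxE expr0n.
  split => //.
  have -> : derive1 (cst p) = cst 0 :> (R -> 'rV[R]_n).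
    by apply/funext => t; rewrite derive1_cst.
  by move=> t; exact: cst_continuous.
have C1' := hypcosh_gt1 hp hx xp.
have S2 := cosh2Bsinh2 d.
have S0 : sinh d != 0.
  by apply: contraTneq C1' => s0; rewrite -Cd -leNgt; move: S2; rewrite s0;
    have := cosh_gt0 d; nra.
(* The lifts of [p] and [x] to the hyperboloid are [(P0, a p)] and [(X0, b x)], and [C] is minus
   their Lorentz product ([abd] below). The unit tangent at [p] pointing to [x] is the lift of [x]
   minus [C] times the lift of [p], divided by [S = sinh d]. The summand [0 *: x] in [A] puts it in
   the form expected by [sqnorm_lin]. *)
pose P0 := (1 + sqnorm p) / (1 - sqnorm p).
pose X0 := (1 + sqnorm x) / (1 - sqnorm x).
pose C := hypcosh p x; pose S := sinh d.
have S0' : S != 0 := S0.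
pose a := 2 / (1 - sqnorm p); pose b := 2 / (1 - sqnorm x).
pose A := 0 *: x + a *: p.
pose T := (b / S) *: x + (- C * a / S) *: p.
pose T0 := (X0 - C * P0) / S.
have eC : C = 1 + 2 * (sqnorm x - 2 * dotv x p + sqnorm p)
    / ((1 - sqnorm x) * (1 - sqnorm p)) by rewrite /C /hypcosh sqnormB.
have ap : a ^+ 2 * sqnorm p = P0 ^+ 2 - 1 by rewrite /a /P0; field.
have bx : b ^+ 2 * sqnorm x = X0 ^+ 2 - 1 by rewrite /b /X0; field.
have abd : a * b * dotv x p = P0 * X0 - C.
  by rewrite eC /a /b /P0 /X0; field; rewrite D0 k0.
have P01 : 1 <= P0.
  by rewrite /P0 ler_pdivlMr ?subr_gt0// mul1r; have := sqnorm_ge0 p; lra.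
have AA : sqnorm A = P0 ^+ 2 - 1 by rewrite sqnorm_lin -ap; ring.
have S2' : S ^+ 2 = C ^+ 2 - 1 by rewrite /C -Cd /S; lra.
have AT : dotv A T = P0 * T0.
  transitivity ((a * b * dotv x p - C * (a ^+ 2 * sqnorm p)) / S).
    have := sum_quadratic x p 0 (a * b / S) (- (C * a ^+ 2 / S)) 0.
    rewrite mul0r add0r mulr0 addr0 mulNr => E.
    rewrite [RHS](_ : _ = a * b / S * dotv x p - C * a ^+ 2 / S * sqnorm p); last by field.
    by rewrite -E; apply: eq_bigr => i _; rewrite !mxE; ring.
  by rewrite abd ap /T0; field.
have TT : sqnorm T = 1 + T0 ^+ 2.
  transitivity ((b ^+ 2 * sqnorm x - 2 * C * (a * b * dotv x p)
      + C ^+ 2 * (a ^+ 2 * sqnorm p)) / S ^+ 2); first by rewrite sqnorm_lin; field.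
  apply: (mulIf (expf_neq0 2 S0')); rewrite divfK ?expf_neq0// abd ap bx.
  have -> : (1 + T0 ^+ 2) * S ^+ 2 = S ^+ 2 + (X0 - C * P0) ^+ 2 by rewrite /T0; field.
  by rewrite S2'; ring.
exists (geod A T P0 T0 d); last exact: riem_length_geod.
have := geod_C1_path d P01 AA AT TT.
congr (C1_path _ _ _ _).
- rewrite /geod /geod_den mul0r cosh0 sinh0 mul1r mul0r addr0 !scale1r scale0r addr0.
  rewrite /A scale0r add0r scalerA -[RHS]scale1r; congr (_ *: _).
  by rewrite /a /P0; field; rewrite k0 /=; lra.
- rewrite /geod /geod_den !mul1r Cd -/C -/S.
  have -> : C *: A + S *: T = b *: x.
    apply/rowP => i; rewrite !mxE; field; exact: S0'.
  rewrite scalerA -[RHS]scale1r; congr (_ *: _).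
  by rewrite /T0 /b /X0; field; rewrite D0 /=; lra.
Qed.

Lemma hyp_ballE (p : 'rV[R]_n) (r : R) : hyp_space p -> 0 < r ->
  hyp_ball p r = [set x | hyp_space x /\ hypcosh p x < cosh r].
Proof.
move=> hp r0; apply/seteqP; split => x [hx].
- rewrite riem_dist_hyp// lte_fin => xr; split => //.
  have C1 := hypcosh_ge1 hp hx.
  by rewrite -(arcoshK C1) ltr_cosh// arcosh_ge0.
- move=> xr; split => //; rewrite riem_dist_hyp// lte_fin.
  by apply: ltr_arcosh => //; [exact: hypcosh_ge1|exact: ltW].
Qed.

End Geodesic.

(** * Maximum principle and supersolutions *)

Section MaximumPrinciple.
Context {R : realType} {n : nat}.
Implicit Types (u w : 'rV[R]_n -> R) (x p : 'rV[R]_n).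

Definition twice_derivable_at u x := forall i : 'I_n,
  (\forall y \near x, derivable u y (delta_mx 0 i)) /\
  derivable (partial i u) x (delta_mx 0 i).

Lemma partial_scale u x (c : R) i : (\forall y \near x, derivable u y (delta_mx 0 i)) ->
  \forall y \near x, c * partial i u y = partial i (fun z => c * u z) y.
Proof.
move=> du; near=> y; have duy : derivable u y (delta_mx 0 i) by near: y.
rewrite /partial; have := is_derive_scale c (derivableP duy).
by case=> _ ->.
Unshelve. all: by end_near. Qed.

Lemma twice_derivable_at_scale u x (c : R) :
  twice_derivable_at u x -> twice_derivable_at (fun z => c * u z) x.
Proof.
move=> du i; have [d1 d2] := du i; split.
  near=> y; have duy : derivable u y (delta_mx 0 i) by near: y.
  by have [] := is_derive_scale c (derivableP duy).
by have [] := near_eq_is_derive (partial_scale c d1) (is_derive_scale c (derivableP d2)).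
Unshelve. all: by end_near. Qed.

Lemma laplacian_scale u x (c : R) : hyp_space x -> twice_derivable_at u x ->
  laplacian hyp_metric (fun z => c * u z) x = c * laplacian hyp_metric u x.
Proof.
move=> xU du; rewrite !laplacian_hypE//; last 2 first.
- by move=> i; case: (du i).
- by move=> i; case: (twice_derivable_at_scale c du i).
rewrite mulrCA; congr (_ * _); rewrite mulr_sumr; apply: eq_bigr => i _.
have [d1 d2] := du i; have pn := partial_scale c d1.
rewrite -(nbhs_singleton pn).
have [_ e] := near_eq_is_derive pn (is_derive_scale c (derivableP d2)).
by rewrite {1}/partial e /partial; ring.
Qed.

Lemma near_line (P : 'rV[R]_n -> Prop) x i : (\forall y \near x, P y) ->
  \forall h \near (0 : R), P (h *: delta_mx 0 i + x).
Proof.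
move=> Px.
have c : {for (0 : R), continuous (fun h : R => h *: (delta_mx 0 i : 'rV[R]_n) + x)}.
  apply: cvgD; last exact: cvg_cst.
  exact: scalel_continuous.
by apply: c; rewrite scale0r add0r.
Qed.

(** Along each coordinate line [u - w] has a local maximum, so first partials agree at [x] and the
    first-order terms of [laplacian_hypE] cancel, while the pure second partials are ordered. *)
Lemma laplacian_le_at_max u w x : hyp_space x ->
  twice_derivable_at u x -> twice_derivable_at w x ->
  (\forall y \near x, u y <= w y) -> u x = w x ->
  laplacian hyp_metric u x <= laplacian hyp_metric w x.
Proof.
move=> xU du dw uw e; have x1 : sqnorm x < 1 := xU.
rewrite !laplacian_hypE//; last 2 first.
- by move=> i; case: (dw i).
- by move=> i; case: (du i).
apply: ler_wpM2l; first by rewrite divr_ge0// sqr_ge0.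
apply: ler_sum => i _.
have [du1 du2] := du i; have [dw1 dw2] := dw i.
pose g (h : R) := u (h *: delta_mx 0 i + x) - w (h *: delta_mx 0 i + x).
pose g1 (h : R) := partial i u (h *: delta_mx 0 i + x) - partial i w (h *: delta_mx 0 i + x).
have shift_line (f : 'rV[R]_n -> R) (h : R) d :
    is_derive (h *: delta_mx 0 i + x) (delta_mx 0 i) f d ->
    is_derive h 1 (fun h : R => f (h *: delta_mx 0 i + x)) d.
  move=> /is_derive_line D; apply/is_derive_line; move: D.
  congr (is_derive _ _ _ _); apply/funext => k.
  by rewrite [_%:A]mulr1 scalerDl addrA.
have [g10 g2] : g1 0 = 0 /\ partial i (partial i u) x - partial i (partial i w) x <= 0.
  apply: (@local_max_derive2 _ g g1).
  - have := near_line i du1; have := near_line i dw1; apply: filterS2 => h dwh duh.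
    by apply: is_derive_sub; apply: shift_line; exact: derivableP.
  - have := near_line i uw; apply: filterS => h; rewrite /g scale0r add0r e subrr.
    by rewrite subr_le0.
  - by apply: is_derive_sub; apply: shift_line; rewrite scale0r add0r; exact: derivableP.
move: g10; rewrite /g1 scale0r add0r => /subr0_eq ->.
by rewrite lerD2r -subr_le0.
Qed.

Lemma twice_derivable_radial p x (F F1 F2 : R -> R) : hyp_space p -> hyp_space x ->
  (\forall c \near hypcosh p x, is_derive (c : R) 1 F (F1 c)) ->
  is_derive (hypcosh p x) 1 F1 (F2 (hypcosh p x)) ->
  twice_derivable_at (fun y => F (hypcosh p y)) x.
Proof.
move=> hp xU dF dF1 i; split; last first.
  by case: (is_derive_partial_radial hp i i xU dF dF1).
have /= dF' := hypcosh_continuous hp xU dF.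
near=> y.
have yU : hyp_space y by near: y; exact: open_nbhs_nbhs (conj hyp_space_open xU).
have dFy : is_derive (hypcosh p y) 1 F (F1 (hypcosh p y)) by near: y.
by case: (partial_radial hp i yU dFy).
Unshelve. all: by end_near. Qed.

Lemma laplacian_radial_dist p x (f f1 f2 : R -> R) :
  hyp_space p -> hyp_space x -> x != p ->
  (forall t : R, 0 < t -> is_derive t 1 f (f1 t)) ->
  (forall t : R, 0 < t -> is_derive t 1 f1 (f2 t)) ->
  let t := arcosh (hypcosh p x) in
  twice_derivable_at (fun y => f (arcosh (hypcosh p y))) x /\
  laplacian hyp_metric (fun y => f (arcosh (hypcosh p y))) x
    = f2 t + (n%:R - 1) * (cosh t / sinh t) * f1 t.
Proof.
move=> hp xU xp df df1 t.
have C1 := hypcosh_gt1 hp xU xp.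
(* [f] and its first two derivatives in the variable [c = cosh t], where [dt/dc = 1 / sinh t]. This
   requires [c > 1], that is [x != p]. *)
pose F (c : R) := f (arcosh c).
pose F1 (c : R) := f1 (arcosh c) / sinh (arcosh c).
pose F2 (c : R) := (f2 (arcosh c) / sinh (arcosh c)
  - f1 (arcosh c) * cosh (arcosh c) / sinh (arcosh c) ^+ 2) / sinh (arcosh c).
have dF c : 1 < c -> is_derive (c : R) 1 F (F1 c).
  by move=> c1; exact: is_derive_compR (is_derive_arcosh c1) (df _ (arcosh_gt0 c1)).
have s0 c : 1 < c -> sinh (arcosh c) != 0 :> R.
  by move=> c1; rewrite gt_eqF// sinh_gt0// arcosh_gt0.
have dF1 c : 1 < c -> is_derive (c : R) 1 F1 (F2 c).
  move=> c1.
  have d1 := is_derive_compR (is_derive_arcosh c1) (df1 _ (arcosh_gt0 c1)).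
  have d2 := is_derive_compR (is_derive_arcosh c1) (is_derive_sinh (arcosh c)).
  apply: (is_derive_val (is_derive_mul d1 (is_derive_inv d2 (s0 _ c1)))).
  by rewrite /F2 /=; field; exact: s0.
have dFn : \forall c \near hypcosh p x, is_derive (c : R) 1 F (F1 c).
  near=> c; apply: dF; near: c; exact: lt_nbhsr.
split; first exact: (twice_derivable_radial hp xU dFn (dF1 _ C1)).
rewrite (laplacian_radial hp xU dFn (dF1 _ C1)) /F1 /F2 -/t.
have -> : hypcosh p x = cosh t by rewrite arcoshK// ltW.
have -> : cosh t ^+ 2 - 1 = sinh t ^+ 2 by have := cosh2Bsinh2 t; lra.
field; exact: s0.
Unshelve. all: by end_near. Qed.

End MaximumPrinciple.

(** * Closure and boundary of geodesic balls *)

Section GeodesicBall.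
Context {R : realType} {n : nat} (p : 'rV[R]_n) (r : R).
Hypotheses (hp : hyp_space p) (r0 : 0 < r).

Lemma hyp_ball_open : open (hyp_ball p r).
Proof.
rewrite hyp_ballE// openE => x [xU xr]; rewrite /interior.
have cC : hypcosh p y @[y --> x] --> hypcosh p x := hypcosh_continuous hp xU.
near=> y; split; near: y; first exact: open_nbhs_nbhs (conj hyp_space_open xU).
exact: (cvgr_lt _ cC).
Unshelve. all: by end_near. Qed.

(** Cleared of denominators, [hypcosh p y <= cosh r] reads [z y <= 0] with [z] continuous on the
    whole space, also across the unit sphere where [hypcosh] breaks down. A point of this closed set
    with [|x| >= 1] would satisfy [|x - p| = 0], which is absurd. *)
Lemma closure_hyp_ball x : closure (hyp_ball p r) x ->
  hyp_space x /\ hypcosh p x <= cosh r.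
Proof.
have p1 : sqnorm p < 1 := hp.
have c1 : 1 < cosh r by rewrite -cosh0 ltr_cosh.
pose z (y : 'rV[R]_n) : R :=
  2 * sqnorm (y - p) - (cosh r - 1) * (1 - sqnorm p) * (1 - sqnorm y).
have cz y : {for y, continuous z}.
  apply: (@continuous_at_sub _ _ (fun y => 2 * sqnorm (y - p))
    (fun y => (cosh r - 1) * (1 - sqnorm p) * (1 - sqnorm y))).
    apply: continuous_at_mul; first exact: continuous_at_const.
    exact: sqnorm_continuous.
  apply: continuous_at_mul; first exact: continuous_at_const.
  exact: conf_continuous.
have Zc : closed (z @^-1` [set t | t <= 0]).
  by apply: closed_comp; [move=> y _; exact: cz|exact: closed_le].
have BZ : hyp_ball p r `<=` z @^-1` [set t | t <= 0].
  rewrite hyp_ballE// => y [/= y1 yr]; have y1' : sqnorm y < 1 := y1.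
  rewrite /z subr_le0; move: yr; rewrite /hypcosh -ltrBrDl ltr_pdivrMr.
    by move=> /ltW/le_trans; apply; rewrite mulrAC mulrA.
  by rewrite mulr_gt0// subr_gt0.
move=> Bx; have := Zc _ (closure_subset BZ Bx).
rewrite /z/= subr_le0 => zx.
have N0 := sqnorm_ge0 (x - p).
have k0 : 0 < (cosh r - 1) * (1 - sqnorm p) by rewrite mulr_gt0// subr_gt0.
have x1 : sqnorm x < 1.
  rewrite ltNge; apply/negP => x1.
  have N00 : sqnorm (x - p) = 0.
    apply/eqP; rewrite eq_le N0 andbT.
    rewrite -(@ler_pM2l _ 2)// mulr0 (le_trans zx)// mulr_ge0_le0 ?(ltW k0)//.
    by rewrite subr_le0.
  by move: x1; rewrite (subr0_eq (sqnorm_eq0 N00)) leNgt p1.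
split => //.
rewrite /hypcosh -lerBrDl ler_pdivrMr; last by rewrite mulr_gt0// subr_gt0.
by rewrite mulrA mulrAC.
Qed.

Lemma closure_hyp_ball_compact : compact (closure (hyp_ball p r)).
Proof.
apply: bounded_closed_compact; last exact: closed_closure.
exists 1; split; first exact: num_real.
move=> M M1 x /closure_hyp_ball[xU _]; have x1 : sqnorm x < 1 := xU.
(* The norm here is the sup norm, which the Euclidean norm dominates. *)
rewrite /= /Num.Def.normr/= mx_normrE; apply: bigmax_le; first by rewrite (le_trans ler01)// ltW.
move=> [i j] _ /=; rewrite (ord1 i) (le_trans _ (ltW M1))//.
rewrite -(@ler_pXn2r _ 2)// ?nnegrE// expr1n real_normK ?num_real//.
apply: le_trans (ltW x1); rewrite /sqnorm (bigD1 j)//= lerDl.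
by apply: sumr_ge0 => k _; exact: sqr_ge0.
Qed.

Lemma boundary_hyp_ball x :
  (closure (hyp_ball p r) `\` (hyp_ball p r)°) x -> hypcosh p x = cosh r.
Proof.
move=> [cx nx]; have [xU xr] := closure_hyp_ball cx.
apply/eqP; rewrite eq_le xr/= leNgt; apply/negP => lt_r; apply: nx.
have /interior_id -> := hyp_ball_open.
by rewrite hyp_ballE.
Qed.

End GeodesicBall.

(** * Comparison of an eigenfunction with a radial supersolution *)

Section BartaBound.
Context {R : realType} {n : nat} (p : 'rV[R]_n) (r lambda Lambda : R).
(** [q] is the reciprocal of [f], extended by [q 0 = 0] where [f] is infinite. It makes the quotient
    [u / f] continuous on the whole closed ball. *)
Context (q f f1 f2 : R -> R).
Hypotheses (hp : hyp_space p) (r0 : 0 < r) (n0 : (0 < n)%N).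
Hypothesis q0 : q 0 = 0.
Hypothesis q_gt0 : forall t : R, 0 < t <= r -> 0 < q t.
Hypothesis q_cont : forall t : R, 0 <= t <= r -> {for t, continuous q}.
Hypothesis qf : forall t : R, 0 < t -> t <= r -> q t * f t = 1.
Hypothesis df : forall t : R, 0 < t -> is_derive t 1 f (f1 t).
Hypothesis df1 : forall t : R, 0 < t -> is_derive t 1 f1 (f2 t).
Hypothesis supersolution : forall t : R, 0 < t < r ->
  f2 t + (n%:R - 1) * (cosh t / sinh t) * f1 t < - Lambda * f t.

Let B := hyp_ball p r.
Let rho x := arcosh (hypcosh p x).

Let rho_bound x : closure B x -> 0 <= rho x <= r.
Proof.
move=> /closure_hyp_ball-/(_ hp r0)[xU xr].
have C1 := hypcosh_ge1 hp xU; rewrite arcosh_ge0//=.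
rewrite leNgt; apply/negP => /(ltr_cosh (ltW r0)).
by rewrite arcoshK// ltNge xr.
Qed.

Let rho_gt0 x : hyp_space x -> x != p -> 0 < rho x.
Proof. by move=> xU xp; apply: arcosh_gt0; exact: hypcosh_gt1. Qed.

(** The function [v] vanishes on the boundary through [u] and at [p] through [q], so its positive
    maximum is attained at an interior point [x0 != p]. There [s u] is touched from above by [v x0]
    times [f (rho)], and comparing Laplacians gives [- lambda < - Lambda]. *)
Lemma barta_lt : dirichlet_eigenvalue hyp_metric B lambda -> Lambda < lambda.
Proof.
move=> [u [uC2 uc ub [x1 Bx1 ux1] ueq]].
have oB : open B := hyp_ball_open hp r0.
have BU x : B x -> hyp_space x by rewrite /B hyp_ballE// => -[].
have Bc x : B x -> closure B x by move=> ?; exact: subset_closure.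
have ucB x : B x -> {for x, continuous u}.
  move=> Bx; have : {within B, continuous u} by exact: continuous_subspaceW uc.
  by rewrite continuous_open_subspace//; apply; rewrite inE.
(* Since [q] vanishes at [p], positivity of [v] needs a point off the centre; if [u] is known to be
   nonzero only at [p], a small move along one axis provides it. *)
have [x2 [Bx2 ux2 x2p]] : exists x2, [/\ B x2, u x2 != 0 & x2 != p].
  have [x1p|x1p] := eqVneq x1 p; last by exists x1.
  pose i := Ordinal n0.
  have near_p : \forall y \near x1, B y /\ u y != 0.
    near=> y; split; near: y; first exact: open_nbhs_nbhs.
    apply: (cvgr_neq0 _ (ucB _ Bx1)); exact: ux1.
  have /nbhs_ballP[e /= e0 He] := near_line i near_p.
  have [] := He (e / 2); first by rewrite /ball/= sub0r normrN gtr0_norm; lra.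
  move=> By uy; exists ((e / 2) *: delta_mx 0 i + x1); split => //.
  rewrite x1p -subr_eq0 addrK; apply/eqP => /rowP/(_ i)/eqP.
  by rewrite !mxE !eqxx/= mulr1 gt_eqF// divr_gt0.
(* A fixed sign, rather than [|u|], keeps the compared function twice derivable. *)
pose s := Num.sg (u x2).
have s2 : s * u x2 > 0 by rewrite /s -normrEsg normr_gt0.
pose v x := s * u x * q (rho x).
have vc : {within closure B, continuous v}.
  have qc : {within closure B, continuous (fun x => q (rho x))}.
    apply: continuous_in_subspaceT => x; rewrite inE => Kx.
    have [xU xr] := closure_hyp_ball hp r0 Kx.
    apply: (@continuous_comp _ _ _ rho q); last exact/q_cont/rho_bound.
    apply: (@continuous_comp _ _ _ (hypcosh p) arcosh).
      exact: hypcosh_continuous.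
    by apply: arcosh_continuous; exact: hypcosh_ge1.
  have sc : {within closure B, continuous (fun=> s)} by move=> x; exact: cst_continuous.
  move=> x; exact: (continuousM (continuousM (sc x) (uc x)) (qc x)).
have K0 : closure B !=set0 by exists x2; exact: Bc.
have [x0 Kx0 x0max] := compact_EVT_max K0 (closure_hyp_ball_compact hp r0) vc.
rewrite inE in Kx0.
have M0 : 0 < v x0.
  apply: lt_le_trans (x0max x2 _); last by rewrite inE; exact: Bc.
  rewrite /v mulr_gt0// q_gt0// rho_gt0//; last exact: BU.
  by have /andP[] := rho_bound (Bc _ Bx2).
have Bx0 : B x0.
  have [|nB] := pselect (B° x0); first exact: interior_subset.
  by move: M0; rewrite /v ub// mulr0 mul0r ltxx.
have x0U := BU _ Bx0.
have x0p : x0 != p.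
  apply: contraTneq M0 => x0p.
  rewrite /v /rho x0p hypcoshxx (_ : arcosh 1 = 0) ?q0 ?mulr0 ?ltxx//.
  by rewrite -[1]cosh0 coshK.
have t0 := rho_gt0 x0U x0p.
have tr : rho x0 < r.
  move: Bx0; rewrite /B hyp_ballE// => -[_ xr].
  by apply: ltr_arcosh => //; [exact: hypcosh_ge1|exact: ltW].
have du : twice_derivable_at u x0.
  move=> i; split; last by have [_ _ +] := uC2 _ Bx0 i i.
  have : \forall y \near x0, B y by exact: open_nbhs_nbhs.
  by apply: filterS => y By; have [+ _ _] := uC2 _ By i i.
have [dw Lw] := laplacian_radial_dist hp x0U x0p df df1.
pose w y := f (rho y).
have cC : hypcosh p y @[y --> x0] --> hypcosh p x0 := hypcosh_continuous hp x0U.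
have le_w : \forall y \near x0, s * u y <= v x0 * w y.
  near=> y.
  have By : B y by near: y; exact: open_nbhs_nbhs.
  have Cy : 1 < hypcosh p y by near: y; apply: (cvgr_gt _ cC); exact: hypcosh_gt1.
  have yp : y != p by apply: contraTneq Cy => ->; rewrite hypcoshxx ltxx.
  have y0 := rho_gt0 (BU _ By) yp.
  have /andP[_ yr] := rho_bound (Bc _ By).
  have qy : 0 < q (rho y) by rewrite q_gt0// y0.
  have wq : w y * q (rho y) = 1 by rewrite mulrC; exact: qf.
  rewrite -(ler_pM2r qy) -[leRHS]mulrA wq mulr1.
  by apply: x0max; rewrite inE; exact: Bc.
have eq_w : s * u x0 = v x0 * w x0.
  by rewrite /v -mulrA qf ?mulr1// ltW.
have w0 : 0 < w x0.
  by have := qf t0 (ltW tr); have := q_gt0 (t := rho x0); rewrite t0 ltW// => /(_ isT);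
    rewrite /w => h e; rewrite -(pmulr_rgt0 _ h) e.
have := laplacian_le_at_max x0U (twice_derivable_at_scale s du)
  (twice_derivable_at_scale (v x0) dw) le_w eq_w.
rewrite !laplacian_scale// Lw -/(rho x0).
have -> : laplacian hyp_metric u x0 = - (lambda * u x0) by rewrite -ueq// opprK.
have sup : f2 (rho x0) + (n%:R - 1) * (cosh (rho x0) / sinh (rho x0)) * f1 (rho x0)
    < - Lambda * w x0 by apply: supersolution; rewrite t0.
set L := f2 _ + _ in sup *; move=> h.
have : v x0 * (- lambda * w x0) < v x0 * (- Lambda * w x0).
  apply: (@le_lt_trans _ _ (v x0 * L)); last by rewrite ltr_pM2l.
  by apply: le_trans h; rewrite mulrCA -eq_w mulNr mulrCA mulrN.
by rewrite ltr_pM2l// ltr_pM2r// ltrN2.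
Unshelve. all: by end_near. Qed.

End BartaBound.

(** * The supersolution in dimension n > 3 *)

Lemma ge_sin {R : realType} (x : R) : 0 <= x -> sin x <= x.
Proof.
move=> x0; rewrite -subr_ge0.
have := @nondecreasing_of_is_derive R (fun y => y - sin y) (fun y => 1 - cos y) 0 x
  (fun y _ => is_derive_sub (is_derive_id y 1) (is_derive_sin y)) _ 0 x (lexx 0) x0 (lexx x).
by rewrite sin0 subrr; apply => y _; rewrite subr_ge0 cos_le1.
Qed.

Section DirichletLowerBound.
Context {R : realType} (N : nat) (r : R).
Hypotheses (r0 : 0 < r).

Let k : R := pi / r.
(** [N] stands for [n - 1], so [m^2 = (n-1)^2 / 4] and [m^2 - m = (n-1)(n-3) / 4]. *)
Let m : R := N%:R / 2.

Let k0 : 0 < k. Proof. by rewrite divr_gt0// pi_gt0. Qed.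

(** The power [sinh^(N/2)], as a root because [N / 2] may be a half-integer. *)
Definition sinh_weight (t : R) : R := Num.sqrt (sinh t ^+ N).

Lemma sinh_weight_gt0 t : 0 < t -> 0 < sinh_weight t.
Proof. by move=> t0; rewrite sqrtr_gt0 exprn_gt0// sinh_gt0. Qed.

Lemma is_derive_sinh_weight (t : R) : 0 < t ->
  is_derive t 1 sinh_weight (N%:R / 2 * (cosh t / sinh t) * sinh_weight t).
Proof.
move=> t0; have s0 := sinh_gt0 t0; have E0 := sinh_weight_gt0 t0.
have sN0 : 0 < sinh t ^+ N by rewrite exprn_gt0.
apply: (is_derive_val (@is_derive_compR R R (fun t => sinh t ^+ N) Num.sqrt t 1 _ _
  (is_derive_exp N (is_derive_sinh t)) (is_derive1_sqrt sN0))).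
rewrite -/(sinh_weight t).
have E2 : sinh_weight t ^+ 2 = sinh t ^+ N by rewrite sqr_sqrtr// ltW.
have e : N%:R * sinh t ^+ N.-1 = N%:R * sinh_weight t ^+ 2 / sinh t.
  rewrite E2; case: (N) => [|j]; first by rewrite !mul0r.
  by rewrite exprS /=; field; rewrite gt_eqF.
by rewrite e; field; rewrite !gt_eqF.
Qed.

Section Perturbation.
Context (d : R).

(** The factor of [d] is [cos (2 k t)], written so that estimates become polynomial in
    [sin (k t)]. *)
Definition pert (t : R) : R := sin (k * t) + d * (1 - 2 * sin (k * t) ^+ 2).

Definition pert1 (t : R) : R :=
  k * (cos (k * t) - d * (4 * (sin (k * t) * cos (k * t)))).

Definition pert2 (t : R) : R := - k ^+ 2 * (sin (k * t)
  + 4 * d * (cos (k * t) ^+ 2 - sin (k * t) ^+ 2)).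

Let dkt (t : R) : is_derive t 1 (fun t => k * t) k.
Proof. by apply: (is_derive_val (is_derive_scale k (is_derive_id t 1))); rewrite mulr1. Qed.

Let dsin (t : R) := is_derive_compR (dkt t) (is_derive_sin (k * t)).
Let dcos (t : R) := is_derive_compR (dkt t) (is_derive_cos (k * t)).

Lemma is_derive_pert (t : R) : is_derive t 1 pert (pert1 t).
Proof.
apply: (is_derive_val (is_derive_add (dsin t) (is_derive_scale d
  (is_derive_sub (is_derive_const 1 t 1) (is_derive_scale 2 (is_derive_exp 2 (dsin t))))))).
by rewrite /pert1 /=; ring.
Qed.

Lemma is_derive_pert1 (t : R) : is_derive t 1 pert1 (pert2 t).
Proof.
apply: (is_derive_val (is_derive_scale k (is_derive_sub (dcos t) (is_derive_scale d
  (is_derive_scale 4 (is_derive_mul (dsin t) (dcos t))))))).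
by rewrite /pert2 /=; ring.
Qed.

(** In [y = sin (k t)], which ranges in [[0, 1]], [pert] is concave with the positive end values [d]
    and [1 - d]. *)
Lemma pert_gt0 t : 0 < d -> d <= 4^-1 -> 0 <= t <= r -> 0 < pert t.
Proof.
move=> d0 d4 /andP[t0 tr]; rewrite /pert.
have y0 : 0 <= sin (k * t).
  apply: sin_ge0_pi; rewrite mulr_ge0 ?(ltW k0)//=.
  by rewrite /k mulrAC ler_pdivrMr// ler_wpM2l// pi_ge0.
have y1 := sin_le1 (k * t).
by move: y0 y1; set y := sin _; nra.
Qed.

Definition barrier (t : R) : R := pert t / sinh_weight t.

Definition barrier1 (t : R) : R :=
  (pert1 t - m * (cosh t / sinh t) * pert t) / sinh_weight t.

Definition barrier2 (t : R) : R := (pert2 t - 2 * m * (cosh t / sinh t) * pert1 t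
  + (m ^+ 2 * (cosh t / sinh t) ^+ 2 + m / sinh t ^+ 2) * pert t) / sinh_weight t.

Lemma is_derive_barrier (t : R) : 0 < t -> is_derive t 1 barrier (barrier1 t).
Proof.
move=> t0; have E0 := lt0r_neq0 (sinh_weight_gt0 t0).
have s0 := lt0r_neq0 (sinh_gt0 t0).
apply: (is_derive_val (is_derive_mul (is_derive_pert t)
  (is_derive_inv (is_derive_sinh_weight t0) E0))).
by rewrite /barrier1 /m; field; rewrite E0 s0.
Qed.

Lemma is_derive_barrier1 (t : R) : 0 < t -> is_derive t 1 barrier1 (barrier2 t).
Proof.
move=> t0; have E0 := lt0r_neq0 (sinh_weight_gt0 t0).
have s0 := lt0r_neq0 (sinh_gt0 t0).
have dcoth := is_derive_mul (is_derive_cosh t) (is_derive_inv (is_derive_sinh t) s0).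
apply: (is_derive_val (is_derive_mul (is_derive_sub (is_derive_pert1 t)
   (is_derive_mul (is_derive_scale m dcoth) (is_derive_pert t)))
  (is_derive_inv (is_derive_sinh_weight t0) E0))).
rewrite /barrier2 /= -/m.
transitivity ((pert2 t - 2 * m * (cosh t / sinh t) * pert1 t
  + (m ^+ 2 * (cosh t / sinh t) ^+ 2 + m * (cosh t ^+ 2 - sinh t ^+ 2) / sinh t ^+ 2)
    * pert t) / sinh_weight t); last by rewrite cosh2Bsinh2 mulr1.
by field; rewrite E0 s0.
Qed.

(** The exponent of the weight is chosen so that the two [pert1] terms cancel, as [N = 2 m];
    [cosh^2 = 1 + sinh^2] then splits the potential. *)
Lemma barrier_equation t : 0 < t ->
  barrier2 t + N%:R * (cosh t / sinh t) * barrier1 t =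
  (pert2 t - (m ^+ 2 + (m ^+ 2 - m) / sinh t ^+ 2) * pert t) / sinh_weight t.
Proof.
move=> t0; have E0 := lt0r_neq0 (sinh_weight_gt0 t0).
have s0 := lt0r_neq0 (sinh_gt0 t0).
have -> : N%:R = 2 * m by rewrite /m; field.
have c2 : cosh t ^+ 2 = 1 + sinh t ^+ 2 by have := cosh2Bsinh2 t; lra.
rewrite /barrier2 /barrier1.
transitivity ((pert2 t - (m ^+ 2 * cosh t ^+ 2 - m) / sinh t ^+ 2 * pert t)
  / sinh_weight t); first by field; rewrite E0 s0.
by rewrite c2; field; rewrite E0 s0.
Qed.

(** The second harmonic has eigenvalue [4 k^2] instead of [k^2]; the surplus [3 k^2] is what the
    perturbation contributes. *)
Lemma pert2E t : pert2 t = - k ^+ 2 * (pert t + 3 * d * (1 - 2 * sin (k * t) ^+ 2)).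
Proof. by rewrite /pert2 /pert cos2sin2; ring. Qed.

End Perturbation.

Let kappa : R := m ^+ 2 - m.
Let V (t : R) : R := kappa / sinh t ^+ 2.

Let V_lt (s t : R) : 0 < kappa -> 0 < s -> s < t -> V t < V s.
Proof.
move=> kap s0 st; rewrite /V ltr_pM2l// ltf_pV2 ?posrE ?exprn_gt0 ?sinh_gt0//;
  last exact: lt_trans s0 st.
by rewrite ltrXn2r// ?nnegrE ?(ltW (sinh_gt0 _)) ?ltr_sinh//; exact: lt_trans s0 st.
Qed.

(* Where [sin (k t) <= 1/2] the perturbation gains [3 k^2 d cos (2 k t) > 0];
   elsewhere [t] stays away from [r], so [V t - V r] is bounded below and
   dominates for small [d]. *)
Lemma exists_perturbation : (2 < N)%N -> exists d : R, [/\ 0 < d, d <= 4^-1 &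
  forall t, 0 < t < r -> pert2 d t - (m ^+ 2 + V t) * pert d t
     < - (m ^+ 2 + k ^+ 2 + V r) * pert d t].
Proof.
move=> N2.
have m1 : 1 < m by rewrite /m ltr_pdivlMr// mul1r ltr_nat.
have kap : 0 < kappa.
  by rewrite /kappa subr_gt0 expr2 ltr_pMr// (lt_trans ltr01).
(* From [sin (k t) <= k (r - t)], the inequality [sin (k t) > 1/2] forces [t < r1]. *)
pose r1 := r - (2 * k)^-1.
have kr : k * r = pi by rewrite /k divfK// gt_eqF.
have ik0 : 0 < (2 * k)^-1 by rewrite invr_gt0 mulr_gt0.
have r10 : 0 < r1.
  have k20 : 0 < 2 * k by exact: mulr_gt0.
  rewrite /r1 subr_gt0 invf_plt ?posrE//.
  rewrite -(ltr_pM2r r0) mulVf ?gt_eqF// -mulrA kr.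
  by have := pi_ge2 R; lra.
have r1r : r1 < r by rewrite /r1 ltrBlDr ltrDl.
pose c := V r1 - V r.
have c0 : 0 < c by rewrite subr_gt0 V_lt.
(* For [sin (k t) > 1/2], [d <= 1/4] gives [pert >= 1/4], so the potential gains more than [c / 4];
   the loss is at most [3 k^2 d <= c / 8]. *)
pose d := Num.min 4^-1 (c / (24 * k ^+ 2)).
have k20 : 0 < k ^+ 2 by rewrite exprn_gt0.
have d0 : 0 < d by rewrite lt_min invr_gt0 ltr0n/= divr_gt0// mulr_gt0.
have d4 : d <= 4^-1 by rewrite ge_min lexx.
have dc : d * (24 * k ^+ 2) <= c.
  have k24 : 0 < 24 * k ^+ 2 by exact: mulr_gt0.
  by rewrite -ler_pdivlMr// /d ge_min lexx orbT.
exists d; split => // t /andP[t0 tr].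
have p0 : 0 < pert d t by apply: pert_gt0 => //; rewrite !ltW.
have Vt : V r < V t by exact: V_lt.
rewrite pert2E; set y := sin (k * t).
suff : 0 < 3 * k ^+ 2 * d * (1 - 2 * y ^+ 2) + (V t - V r) * pert d t by lra.
have kt : 0 < k * t by rewrite mulr_gt0.
have ktpi : k * t < pi by rewrite -kr ltr_pM2l.
have y0 : 0 < y by apply: sin_gt0_pi; rewrite kt ktpi.
have y1 : y <= 1 := sin_le1 _.
have kd : 0 < 3 * k ^+ 2 * d by apply: mulr_gt0 => //; exact: mulr_gt0.
have [y2|y2] := leP y (2^-1).
  apply: addr_gt0; last by rewrite mulr_gt0// subr_gt0.
  have h : 0 < 1 - 2 * y ^+ 2 by nra.
  by apply: mulr_gt0 => //.
have tr1 : t < r1.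
  have k2 : 0 < 2 * k by exact: mulr_gt0.
  rewrite /r1 ltrBrDr -ltrBrDl invf_plt ?posrE ?subr_gt0//.
  have : y <= pi - k * t.
    have -> : y = sin (pi - k * t) by rewrite sinB sinpi cospi mul0r sub0r mulN1r opprK.
    by apply: ge_sin; rewrite subr_ge0 ltW.
  rewrite -kr -mulrBr => h.
  rewrite -(ltr_pM2r (_ : 0 < r - t)) ?subr_gt0// mulVf ?gt_eqF ?subr_gt0//.
  lra.
have Vc : c < V t - V r by rewrite /c ltrD2r V_lt.
have yy : 0 <= 1 - y ^+ 2 by rewrite subr_ge0 expr_le1// ltW.
have p4 : 4^-1 <= pert d t.
  by have := mulr_ge0 (ltW d0) yy; rewrite /pert -/y; lra.
have : c * 4^-1 < (V t - V r) * pert d t.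
  apply: (@lt_le_trans _ _ ((V t - V r) * 4^-1)); first by rewrite ltr_pM2r// invr_gt0.
  by rewrite ler_pM2l// (lt_trans c0).
have : 3 * k ^+ 2 * d * (1 - 2 * y ^+ 2) >= - (3 * k ^+ 2 * d).
  have := mulr_ge0 (ltW kd) yy; lra.
lra.
Qed.

End DirichletLowerBound.

Lemma dirichlet_eigenvalue_gt (R : realType) (n : nat) (p : 'rV[R]_n) (r lambda : R) :
  hyp_space p -> 0 < r -> (3 < n)%N ->
  dirichlet_eigenvalue hyp_metric (hyp_ball p r) lambda ->
  (n%:R - 1) ^+ 2 / 4 + pi ^+ 2 / r ^+ 2
    + (n%:R - 1) * (n%:R - 3) / (4 * sinh r ^+ 2) < lambda.
Proof.
move=> hp r0; case: n p hp => // N p hp N2 ev.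
have [d [d0 d4 dP]] := @exists_perturbation R N r r0 N2.
have sr0 : sinh r != 0 by rewrite gt_eqF// sinh_gt0.
apply: (@barta_lt R N.+1 p r lambda _ (fun t => sinh_weight N t / pert r d t)
  (barrier N r d) (barrier1 N r d) (barrier2 N r d) hp r0 isT _ _ _ _ _ _ _ ev).
- have /negbTE N0 : N != 0%N by rewrite -lt0n; case: (N) N2.
  by rewrite /sinh_weight sinh0 expr0n N0 sqrtr0 mul0r.
- move=> t /andP[t0 tr]; rewrite divr_gt0 ?sinh_weight_gt0 ?pert_gt0//.
  by rewrite tr ltW.
- move=> t t0r; apply: continuous_at_mul.
    apply: (@continuous_comp _ _ _ (fun t => sinh t ^+ N) Num.sqrt).
      by apply: continuous_at_exp; exact: is_derive_continuous (is_derive_sinh t).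
    exact: sqrt_continuous.
  apply: continuous_at_inv; first by rewrite gt_eqF// pert_gt0.
  exact: is_derive_continuous (is_derive_pert r d t).
- move=> t t0 tr; have E0 := lt0r_neq0 (sinh_weight_gt0 N t0).
  have p0 : pert r d t != 0 by rewrite gt_eqF// pert_gt0// tr ltW.
  by rewrite /barrier; field; rewrite E0 p0.
- by move=> t t0; exact: is_derive_barrier.
- by move=> t t0; exact: is_derive_barrier1.
- move=> t /[dup] t0r /andP[t0 tr].
  have -> : N.+1%:R - 1 = N%:R :> R by rewrite -natr1 addrK.
  rewrite barrier_equation// /barrier mulrA ltr_pM2r ?invr_gt0 ?sinh_weight_gt0//.
  apply: lt_le_trans (dP t t0r) _.
  rewrite le_eqVlt; apply/orP; left; apply/eqP; congr (- _ * _).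
  by rewrite -natr1; field; rewrite sr0 gt_eqF.
Qed.

(** * Radial solutions as power series *)

Section SubexponentialSeries.
Context {R : realType}.
Implicit Types (c d : R^nat) (t q : R).

(** A growth condition that ensures convergence on [|t| < 1] and is stable under linear
    combinations, shifts and termwise differentiation. *)
Definition subexp c := forall q, 1 < q -> exists M : R, forall k, `|c k| <= M * q ^+ k.

Definition ps c t : R := limn (pseries c t).

Lemma subexp_cvg c t : subexp c -> `|t| < 1 -> cvgn (pseries c t).
Proof.
move=> sc t1.
have t0 : 0 <= `|t| by [].
(* Chosen so that [q > 1] and [q |t| < 1], giving a convergent geometric majorant. *)
pose q := 2 / (1 + `|t|).
have q1 : 1 < q by rewrite /q ltr_pdivlMr; lra.
have [M HM] := sc q q1.
have M0 : 0 <= M by have := HM 0%N; rewrite expr0 mulr1; apply: le_trans.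
apply: normed_cvg.
apply: (@series_le_cvg _ _ (geometric M (q * `|t|))).
- by move=> k; exact: normr_ge0.
- by move=> k; rewrite /= mulr_ge0// exprn_ge0// mulr_ge0// ltW// (lt_trans ltr01).
- move=> k; rewrite /= normrM normrX exprMn mulrA.
  by rewrite ler_wpM2r// exprn_ge0.
apply: is_cvg_geometric_series.
rewrite normrM normr_id gtr0_norm ?(lt_trans ltr01)//.
by rewrite /q mulrAC ltr_pdivrMr; lra.
Qed.

Lemma subexp_le c d : (forall k, `|c k| <= `|d k|) -> subexp d -> subexp c.
Proof.
by move=> cd sd q /sd[M HM]; exists M => k; exact: le_trans (cd k) (HM k).
Qed.

Lemma subexp_add c d : subexp c -> subexp d -> subexp (fun k => c k + d k).
Proof.
move=> sc sd q q1; have [M HM] := sc q q1; have [M' HM'] := sd q q1.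
exists (M + M') => k; rewrite mulrDl; apply: le_trans (ler_normD _ _) _.
exact: lerD.
Qed.

Lemma subexp_scale (a : R) c : subexp c -> subexp (fun k => a * c k).
Proof.
move=> sc q q1; have [M HM] := sc q q1; exists (`|a| * M) => k.
by rewrite normrM -mulrA ler_wpM2l.
Qed.

(** The factor [k + 1] is absorbed by passing from [q'] to the larger [q = q' (1 + x)]: Bernoulli's
    inequality bounds [(1 + x)^k] below by [1 + k x]. *)
Lemma subexp_diffs c : subexp c -> subexp (pseries_diffs c).
Proof.
move=> sc q q1; pose q' := (1 + q) / 2.
have q'1 : 1 < q' by rewrite /q'; lra.
have q'0 : 0 < q' by exact: lt_trans ltr01 q'1.
have [M HM] := sc q' q'1.
have M0 : 0 <= M by have := HM 0%N; rewrite expr0 mulr1; apply: le_trans.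
pose x := q / q' - 1.
have x0 : 0 < x by rewrite subr_gt0 ltr_pdivlMr// mul1r /q'; lra.
have bern k : 1 + k%:R * x <= (1 + x) ^+ k.
  elim: k => [|k ih]; first by rewrite mul0r addr0 expr0.
  rewrite exprS; apply: (@le_trans _ _ ((1 + x) * (1 + k%:R * x))).
    by rewrite -natr1; have := ler0n R k; nra.
  by rewrite ler_wpM2l// addr_ge0// ltW.
exists (M * q' * (1 + x^-1)) => k; rewrite /pseries_diffs normrM ger0_norm//.
have e : q ^+ k = q' ^+ k * (1 + x) ^+ k.
  by rewrite -exprMn /x; congr (_ ^+ _); field; exact: lt0r_neq0.
apply: (@le_trans _ _ (k.+1%:R * (M * q' ^+ k.+1))); first by rewrite ler_wpM2l.
rewrite e exprS.
have -> : k.+1%:R * (M * (q' * q' ^+ k)) = M * q' * q' ^+ k * k.+1%:R by ring.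
have -> : M * q' * (1 + x^-1) * (q' ^+ k * (1 + x) ^+ k)
   = M * q' * q' ^+ k * ((1 + x^-1) * (1 + x) ^+ k) by ring.
apply: ler_wpM2l.
  exact: mulr_ge0 (mulr_ge0 M0 (ltW q'0)) (exprn_ge0 k (ltW q'0)).
apply: (@le_trans _ _ ((1 + x^-1) * (1 + k%:R * x))).
  have -> : (1 + x^-1) * (1 + k%:R * x) = k.+1%:R + (k%:R * x + x^-1).
    by rewrite -natr1; field; exact: lt0r_neq0.
  by rewrite lerDl addr_ge0// ?mulr_ge0// ?invr_ge0// ltW.
by apply: ler_wpM2l; rewrite // addr_ge0// invr_ge0 ltW.
Qed.

Lemma is_derive_ps c t : subexp c -> `|t| < 1 ->
  is_derive t 1 (ps c) (ps (pseries_diffs c) t).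
Proof.
move=> sc t1; pose K := (1 + `|t|) / 2.
have K0 : 0 <= K by rewrite /K; have := normr_ge0 t; lra.
have K1 : `|K| < 1 by rewrite ger0_norm// /K; lra.
have tK : `|t| < `|K| by rewrite [ltRHS]ger0_norm// /K; lra.
have sc1 := subexp_diffs sc; have sc2 := subexp_diffs sc1.
exact: (pseries_snd_diffs (subexp_cvg sc K1) (subexp_cvg sc1 K1)
  (subexp_cvg sc2 K1) tK).
Qed.

Lemma ps_add c d t : subexp c -> subexp d -> `|t| < 1 ->
  ps (fun k => c k + d k) t = ps c t + ps d t.
Proof.
move=> sc sd t1; apply/cvg_lim => //.
have -> : pseries (fun k => c k + d k) t = pseries c t + pseries d t.
  apply/funext => n; rewrite /pseries /series fctE -big_split/=.
  by apply: eq_bigr => k _; rewrite mulrDl.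
exact: cvgD (subexp_cvg sc t1) (subexp_cvg sd t1).
Qed.

Lemma ps_scale (a : R) c t : subexp c -> `|t| < 1 ->
  ps (fun k => a * c k) t = a * ps c t.
Proof.
move=> sc t1; apply/cvg_lim => //.
have -> : pseries (fun k => a * c k) t = (fun=> a) \* pseries c t.
  apply/funext => n; rewrite /pseries /series /= mulr_sumr.
  by apply: eq_bigr => k _; rewrite mulrA.
by apply: cvgM; [exact: cvg_cst|exact: subexp_cvg].
Qed.

Definition shift_seq c : R^nat := fun k => if k is j.+1 then c j else 0.

Lemma subexp_shift c : subexp c -> subexp (shift_seq c).
Proof.
move=> sc q q1; have [M HM] := sc q q1; exists M => -[|k] /=.
  by rewrite normr0 expr0 mulr1; have := HM 0%N; rewrite expr0 mulr1; apply: le_trans.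
apply: (le_trans (HM k)); have M0 : 0 <= M.
  by have := HM 0%N; rewrite expr0 mulr1; apply: le_trans.
by rewrite ler_wpM2l// exprS ler_peMl ?exprn_ge0// ltW// (lt_trans ltr01).
Qed.

Lemma ps_shift c t : subexp c -> `|t| < 1 -> ps (shift_seq c) t = t * ps c t.
Proof.
move=> sc t1; apply/cvg_lim => //.
rewrite -cvg_shiftS.
have -> : (fun n => pseries (shift_seq c) t n.+1) = (fun=> t) \* pseries c t.
  apply/funext => n; rewrite /pseries /series /= big_nat_recl//= mul0r add0r mulr_sumr.
  by apply: eq_bigr => k _; rewrite exprS mulrCA.
by apply: cvgM; [exact: cvg_cst|exact: subexp_cvg].
Qed.

(** Multiplying by [1 - t] replaces coefficients by their successive differences, which undoes
    partial summation. *)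
Lemma ps_summation c d t : subexp c -> subexp d -> `|t| < 1 ->
  c 0%N = d 0%N -> (forall k, c k.+1 = c k + d k.+1) ->
  (1 - t) * ps c t = ps d t.
Proof.
move=> sc sd t1 c0 cS.
have : ps c t = t * ps c t + ps d t.
  rewrite -ps_shift// -ps_add//; last exact: subexp_shift.
  by congr ps; apply/funext => -[|k] /=; rewrite ?add0r.
lra.
Qed.

Lemma ps_norm_le c d t T : subexp c -> subexp d -> (forall k, `|c k| <= d k) ->
  0 <= t <= T -> T < 1 -> `|ps c t| <= ps d T.
Proof.
move=> sc sd cd /andP[t0 tT] T1.
have T0 : 0 <= T := le_trans t0 tT.
have cc : cvgn (pseries c t) by apply: subexp_cvg => //; rewrite ger0_norm//; lra.
have cT : cvgn (pseries d T) by apply: subexp_cvg => //; rewrite ger0_norm.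
have d0 k : 0 <= d k := le_trans (normr_ge0 _) (cd k).
have term n : `|pseries c t n| <= pseries d T n.
  rewrite /pseries /series/=; apply: le_trans (ler_norm_sum _ _ _) _.
  apply: ler_sum => k _; rewrite normrM normrX (ger0_norm t0).
  by rewrite ler_pM// ?exprn_ge0// lerXn2r// nnegrE.
rewrite ler_norml; apply/andP; split.
  rewrite lerNl -limN//; apply: ler_lim => //; first exact: is_cvgN.
  by near=> n; have := term n; rewrite ler_norml => /andP[h _]; rewrite lerNl.
apply: ler_lim => //.
by near=> n; have := term n; rewrite ler_norml => /andP[].
Unshelve. all: by end_near. Qed.

Lemma ps0 c : ps c 0 = c 0%N.
Proof.
apply/cvg_lim => //; rewrite -cvg_shiftS.
have -> : (fun n => pseries c 0 n.+1) = cst (c 0%N).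
  apply/funext => n; rewrite /pseries /series/= big_nat_recl//= expr0 mulr1.
  by rewrite big1 ?addr0// => k _; rewrite expr0n mulr0.
exact: cvg_cst.
Qed.

End SubexponentialSeries.

(** * The radial solution and its dependence on the parameter *)

Section RadialSeries.
Context {R : realType}.
Implicit Types (l : R) (k : nat).

(* The coefficients [a k] of the regular solution of
   [(1 - t)^2 (t y'' + y') = - l y], with the partial sums [s] of [a] and the
   partial sums [S] of [s]: dividing by [(1 - t)^2] sums coefficients twice. *)
Fixpoint radial_coefs l k : R * R * R :=
  if k is j.+1 then
    let: (a, s, z) := radial_coefs l j in
    let a' := - l * z / j.+1%:R ^+ 2 in (a', s + a', z + (s + a'))
  else (1, 1, 1).

Definition rad_a l k := (radial_coefs l k).1.1.
Definition rad_s l k := (radial_coefs l k).1.2.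
Definition rad_S l k := (radial_coefs l k).2.

Lemma rad_aS l k : rad_a l k.+1 = - l * rad_S l k / k.+1%:R ^+ 2.
Proof. by rewrite /rad_a /rad_S /=; case: (radial_coefs l k) => [[]]. Qed.

Lemma rad_sS l k : rad_s l k.+1 = rad_s l k + rad_a l k.+1.
Proof. by rewrite /rad_s /rad_a /=; case: (radial_coefs l k) => [[]]. Qed.

Lemma rad_SS l k : rad_S l k.+1 = rad_S l k + rad_s l k.+1.
Proof. by rewrite /rad_S /rad_s /=; case: (radial_coefs l k) => [[]]. Qed.

(** With [h = q - 1], the quantity [N k = |s k| + h |S k|] eventually grows by a factor at most [q]:
    the recursion without [a] gives this factor on [|s|] and leaves slack [h^2 |S k|], which pays
    for [(1 + h) |a k.+1|] because of the division by [(k + 1)^2]. Finally [a] is the difference of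
    consecutive [s]. *)
Lemma subexp_rad l : [/\ subexp (rad_a l), subexp (rad_s l) & subexp (rad_S l)].
Proof.
have main q : 1 < q -> exists M, forall k,
    `|rad_s l k| + (q - 1) * `|rad_S l k| <= M * q ^+ k.
  move=> q1; pose h := q - 1; have h0 : 0 < h by rewrite subr_gt0.
  pose N k := `|rad_s l k| + h * `|rad_S l k|.
  have N0 k : 0 <= N k by rewrite addr_ge0// mulr_ge0// ltW.
  (* Once [(k + 1)^2 >= A], the new coefficient fits into the slack [h^2 |S k|]. *)
  pose A := (1 + h) * `|l| / h ^+ 2.
  pose K := (Num.truncn A).+1.
  have AK k : (K <= k)%N -> A <= k%:R.
    move=> Kk; apply: (@le_trans _ _ K%:R); last by rewrite ler_nat.
    exact: ltW (truncnS_gt A).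
  have step k : (K <= k)%N -> N k.+1 <= q * N k.
    move=> /AK Ak.
    have k1 : 1 <= k.+1%:R :> R by rewrite ler1n.
    have Ak2 : A <= k.+1%:R ^+ 2.
      apply: (le_trans Ak); apply: (@le_trans _ _ k.+1%:R); first by rewrite ler_nat.
      by rewrite expr2 ler_peMl// ltW// (lt_le_trans ltr01).
    have ha : (1 + h) * `|rad_a l k.+1| <= h ^+ 2 * `|rad_S l k|.
      rewrite rad_aS !normrM normrN normfV normrX [`|k.+1%:R|]ger0_norm//.
      rewrite !mulrA ler_pdivrMr; last by rewrite exprn_gt0// (lt_le_trans ltr01).
      rewrite [leRHS]mulrAC; apply: ler_wpM2r => //.
      by move: Ak2; rewrite /A ler_pdivrMr ?exprn_gt0// [leRHS]mulrC.
    have hs : `|rad_s l k.+1| <= `|rad_s l k| + `|rad_a l k.+1|.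
      by rewrite rad_sS ler_normD.
    have hS : `|rad_S l k.+1| <= `|rad_S l k| + `|rad_s l k.+1|.
      by rewrite rad_SS ler_normD.
    rewrite /N (_ : q = 1 + h); last by rewrite /h; ring.
    move: ha hs hS (normr_ge0 (rad_S l k)) (normr_ge0 (rad_s l k)).
    by set a := `|rad_a _ _|; set s := `|rad_s _ k.+1|; set s' := `|rad_s _ k|;
      set z := `|rad_S _ k.+1|; set z' := `|rad_S _ k|; nra.
  (* This constant covers the finitely many indices before the growth estimate starts. *)
  exists (\sum_(j < K.+1) N j) => k.
  have M0 : 0 <= \sum_(j < K.+1) N j by apply: sumr_ge0.
  have small j : (j <= K)%N -> N j <= (\sum_(j < K.+1) N j) * q ^+ j.
    move=> jK; apply: (@le_trans _ _ (\sum_(j < K.+1) N j)).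
      by rewrite (bigD1 (Ordinal (jK : (j < K.+1)%N)))//= lerDl sumr_ge0.
    by rewrite ler_peMr// exprn_ege1// ltW.
  elim: k => [|k ih]; first exact: (small 0%N).
  have [/small//|Kk] := leqP k.+1 K.
  apply: (le_trans (step k Kk)); rewrite exprS mulrCA ler_wpM2l//.
  by rewrite ltW// (lt_trans ltr01).
have ss : subexp (rad_s l).
  move=> q q1; have [M HM] := main q q1; exists M => k; apply: le_trans (HM k).
  by rewrite lerDl mulr_ge0// subr_ge0 ltW.
have sS : subexp (rad_S l).
  move=> q q1; have [M HM] := main q q1; exists (M / (q - 1)) => k.
  rewrite mulrAC ler_pdivlMr ?subr_gt0// mulrC; apply: le_trans (HM k).
  by rewrite lerDr.
split => //.
apply: (@subexp_le _ _ (fun k => rad_s l k + -1 * shift_seq (rad_s l) k)).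
  by case=> [|k] /=; rewrite ?mulr0 ?addr0// rad_sS mulN1r addrAC subrr add0r.
by apply: subexp_add => //; apply: subexp_scale; exact: subexp_shift.
Qed.

Definition rad_y l := ps (rad_a l).
Definition rad_y1 l := ps (pseries_diffs (rad_a l)).
Definition rad_y2 l := ps (pseries_diffs (pseries_diffs (rad_a l))).
Definition rad_y3 l := ps (pseries_diffs (pseries_diffs (pseries_diffs (rad_a l)))).

Lemma is_derive_rad_y l (t : R) : `|t| < 1 -> is_derive t 1 (rad_y l) (rad_y1 l t).
Proof. by move=> t1; apply: is_derive_ps => //; case: (subexp_rad l). Qed.

Lemma is_derive_rad_y1 l (t : R) : `|t| < 1 -> is_derive t 1 (rad_y1 l) (rad_y2 l t).
Proof.
by move=> t1; apply: is_derive_ps => //; apply: subexp_diffs; case: (subexp_rad l).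
Qed.

Lemma is_derive_rad_y2 l (t : R) : `|t| < 1 -> is_derive t 1 (rad_y2 l) (rad_y3 l t).
Proof.
by move=> t1; apply: is_derive_ps => //; do 2 apply: subexp_diffs; case: (subexp_rad l).
Qed.

Lemma rad_y0 l : rad_y l 0 = 1.
Proof. exact: ps0. Qed.

(** The coefficient of [t^k] in [t y'' + y'] is [(k+1)^2 a (k+1) = - l S k], and each factor [1 - t]
    undoes one of the two summations leading from [a] to [S]. *)
Lemma rad_y_ode l (t : R) : `|t| < 1 ->
  (1 - t) ^+ 2 * (t * rad_y2 l t + rad_y1 l t) = - l * rad_y l t.
Proof.
move=> t1; have [sa ss sS] := subexp_rad l.
have sa1 := subexp_diffs sa; have sa2 := subexp_diffs sa1.
have -> : t * rad_y2 l t + rad_y1 l t = - l * ps (rad_S l) t.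
  rewrite -ps_shift// -ps_add//; last exact: subexp_shift.
  rewrite -ps_scale//; congr ps; apply/funext => -[|k].
    by rewrite /= /pseries_diffs add0r mul1r rad_aS expr1n divr1.
  rewrite /= /pseries_diffs [in RHS](_ : - l * rad_S l k.+1
    = k.+2%:R ^+ 2 * rad_a l k.+2); last by rewrite rad_aS; field.
  have -> : k.+2%:R = k.+1%:R + 1 :> R by rewrite natr1.
  ring.
rewrite mulrCA expr2 -mulrA (@ps_summation _ _ (rad_s l))//; last exact: rad_SS.
by rewrite (@ps_summation _ _ (rad_a l))//; exact: rad_sS.
Qed.

(** The sequence with parameter [-(L + 1)] is a majorant for both. In [l S(l) - l' S(l') = l (S(l) -
    S(l')) + (l - l') S(l')] the first term costs the factor [L] and the second the extra 1. The
    bound on the coefficients at [l'] is carried through the induction for that second term. *)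
Lemma rad_lipschitz (L l l' : R) : `|l| <= L -> `|l'| <= L -> forall k,
  `|rad_a l k - rad_a l' k| <= `|l - l'| * rad_a (- (L + 1)) k.
Proof.
move=> lL l'L; have L0 : 0 <= L := le_trans (normr_ge0 _) lL.
pose ok (f : R -> nat -> R) k :=
  [/\ `|f l' k| <= f (- (L + 1)) k & `|f l k - f l' k| <= `|l - l'| * f (- (L + 1)) k].
suff H k : [/\ ok rad_a k, ok rad_s k & ok rad_S k] by move=> k; case: (H k) => -[].
elim: k => [|k [[a1 a2] [s1 s2] [S1 S2]]].
  by split; split; rewrite /= ?normr1 ?subrr ?normr0 ?mulr1.
have [a1' a2'] : ok rad_a k.+1.
  have iv : 0 <= (k.+1%:R ^+ 2)^-1 :> R by rewrite invr_ge0 exprn_ge0.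
  split; rewrite !rad_aS opprK.
    rewrite !normrM normrN (ger0_norm iv); apply: ler_wpM2r => //.
    apply: ler_pM => //; lra.
  rewrite -mulrBl normrM (ger0_norm iv) mulrA; apply: ler_wpM2r => //.
  have -> : - l * rad_S l k - - l' * rad_S l' k
    = - (l * (rad_S l k - rad_S l' k)) - (l - l') * rad_S l' k by ring.
  apply: (le_trans (ler_normB _ _)); rewrite normrN !normrM.
  have -> : `|l - l'| * ((L + 1) * rad_S (- (L + 1)) k)
    = L * (`|l - l'| * rad_S (- (L + 1)) k) + `|l - l'| * rad_S (- (L + 1)) k by ring.
  by apply: lerD; [exact: ler_pM|exact: ler_wpM2l].
have [s1' s2'] : ok rad_s k.+1.
  split; rewrite !rad_sS; first exact: le_trans (ler_normD _ _) (lerD s1 a1').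
  rewrite opprD addrACA mulrDr; exact: le_trans (ler_normD _ _) (lerD s2 a2').
split => //; split; rewrite !rad_SS; first exact: le_trans (ler_normD _ _) (lerD S1 s1').
by rewrite opprD addrACA mulrDr; exact: le_trans (ler_normD _ _) (lerD S2 s2').
Qed.

Lemma rad_y_lipschitz (L T : R) : 0 <= L -> 0 <= T < 1 -> exists C : R, 0 < C /\
  forall l l' t, `|l| <= L -> `|l'| <= L -> 0 <= t <= T ->
  `|rad_y l t - rad_y l' t| <= C * `|l - l'|.
Proof.
move=> L0 /andP[T0 T1].
exists (`|rad_y (- (L + 1)) T| + 1); split; first by rewrite ltr_pwDr.
move=> l l' t lL l'L /[dup] tT /andP[t0 tT'].
have t1 : `|t| < 1 by rewrite ger0_norm// (le_lt_trans tT').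
have [sa _ _] := subexp_rad l; have [sa' _ _] := subexp_rad l'.
have [sL _ _] := subexp_rad (- (L + 1)).
have -> : rad_y l t - rad_y l' t = ps (fun k => rad_a l k + -1 * rad_a l' k) t.
  by rewrite ps_add//; [rewrite ps_scale// mulN1r|exact: subexp_scale].
have T1' : `|T| < 1 by rewrite ger0_norm.
apply: (@le_trans _ _ (`|l - l'| * rad_y (- (L + 1)) T)).
  rewrite -ps_scale//; apply: ps_norm_le => //.
  - by apply: subexp_add => //; exact: subexp_scale.
  - exact: subexp_scale.
  - by move=> k; rewrite mulN1r; exact: rad_lipschitz.
rewrite mulrC; apply: ler_wpM2r => //.
by rewrite (le_trans (ler_norm _))// lerDl.
Qed.

End RadialSeries.

(** * The two-dimensional upper bound *)

Section CayleyVariable.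
Context {R : realType}.
Implicit Types (l c : R).

(* [tanh2half (cosh s) = tanh (s / 2) ^+ 2] *)
Definition tanh2half c : R := (c - 1) / (c + 1).

Lemma tanh2half_norm c : 0 < c -> `|tanh2half c| < 1.
Proof.
move=> c0; have c1 : 0 < c + 1 by rewrite addr_gt0.
rewrite /tanh2half ltr_norml ltr_pdivlMr// ltr_pdivrMr//.
by apply/andP; split; lra.
Qed.

Lemma tanh2half_le c d : 0 < c -> c <= d -> tanh2half c <= tanh2half d.
Proof.
move=> c0 cd; rewrite /tanh2half ler_pdivrMr; last by lra.
by rewrite mulrAC ler_pdivlMr; nra.
Qed.

Lemma tanh2half_ge0 c : 1 <= c -> 0 <= tanh2half c.
Proof. by move=> c1; rewrite /tanh2half divr_ge0//; lra. Qed.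

Lemma is_derive_tanh2half c : 0 < c ->
  is_derive c 1 tanh2half (2 / (c + 1) ^+ 2).
Proof.
move=> c0; have c1 : c + 1 != 0 by rewrite gt_eqF// addr_gt0.
apply: (is_derive_val (is_derive_mul
  (is_derive_sub (is_derive_id c 1) (is_derive_const 1 c 1))
  (is_derive_inv (is_derive_add (is_derive_id c 1) (is_derive_const 1 c 1)) c1))).
by rewrite /=; field.
Qed.

Definition rad_F l c := rad_y l (tanh2half c).
Definition rad_F1 l c := rad_y1 l (tanh2half c) * (2 / (c + 1) ^+ 2).
Definition rad_F2 l c := rad_y2 l (tanh2half c) * (2 / (c + 1) ^+ 2) ^+ 2
  - rad_y1 l (tanh2half c) * (4 / (c + 1) ^+ 3).

Lemma is_derive_rad_F l c : 0 < c -> is_derive c 1 (rad_F l) (rad_F1 l c).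
Proof.
move=> c0; exact: (is_derive_compR (is_derive_tanh2half c0)
  (is_derive_rad_y l (tanh2half_norm c0))).
Qed.

Let is_derive_slope c : 0 < c ->
  is_derive c 1 (fun z => 2 / (z + 1) ^+ 2) (- (4 / (c + 1) ^+ 3)).
Proof.
move=> c0; have c1 : c + 1 != 0 by rewrite gt_eqF// addr_gt0.
apply: (is_derive_val (is_derive_scale 2 (is_derive_inv (is_derive_exp 2
  (is_derive_add (is_derive_id c 1) (is_derive_const 1 c 1))) (expf_neq0 2 c1)))).
by rewrite /=; field.
Qed.

Lemma is_derive_rad_F1 l c : 0 < c -> is_derive c 1 (rad_F1 l) (rad_F2 l c).
Proof.
move=> c0; have c1 : c + 1 != 0 by rewrite gt_eqF// addr_gt0.
apply: (is_derive_val (is_derive_mul (is_derive_compR (is_derive_tanh2half c0)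
  (is_derive_rad_y1 l (tanh2half_norm c0))) (is_derive_slope c0))).
by rewrite /rad_F2 /=; ring.
Qed.

Lemma rad_F2_continuous l c : 0 < c -> {for c, continuous (rad_F2 l)}.
Proof.
move=> c0; have c1 : c + 1 != 0 by rewrite gt_eqF// addr_gt0.
have d1 := is_derive_compR (is_derive_tanh2half c0)
  (is_derive_rad_y2 l (tanh2half_norm c0)).
have d2 := is_derive_compR (is_derive_tanh2half c0)
  (is_derive_rad_y1 l (tanh2half_norm c0)).
have d3 := is_derive_scale 4 (is_derive_inv (is_derive_exp 3
  (is_derive_add (is_derive_id c 1) (is_derive_const 1 c 1))) (expf_neq0 3 c1)).
exact: is_derive_continuous (is_derive_sub
  (is_derive_mul d1 (is_derive_exp 2 (is_derive_slope c0))) (is_derive_mul d2 d3)).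
Qed.

(** The radial equation of [laplacian_radial] for [n = 2]. As [1 - t = 2 / (c + 1)] for
    [t = tanh2half c], it is [rad_y_ode] in another variable; since [t] stays in [[0, 1)] for
    [c >= 1], a single power series covers the whole hyperbolic plane. *)
Lemma rad_F_ode l c : 0 < c ->
  (c ^+ 2 - 1) * rad_F2 l c + 2 * c * rad_F1 l c = - l * rad_F l c.
Proof.
move=> c0; have c1 : c + 1 != 0 by rewrite gt_eqF// addr_gt0.
rewrite /rad_F -rad_y_ode ?tanh2half_norm// /rad_F2 /rad_F1.
set y1 := rad_y1 _ _; set y2 := rad_y2 _ _.
by rewrite /tanh2half; field.
Qed.

End CayleyVariable.

Lemma near_eq_continuous {R : realType} {V : normedModType R} (f g : V -> R) (x : V) :
  (\forall y \near x, f y = g y) -> {for x, continuous f} -> {for x, continuous g}.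
Proof.
move=> fg cf; suff : g y @[y --> x] --> g x by [].
rewrite -(nbhs_singleton fg); apply: cvg_trans cf.
by apply: near_eq_cvg; apply: filterS fg => y ->.
Qed.

(** * Radial Dirichlet eigenfunctions in the hyperbolic plane *)

Section RadialEigenfunction.
Context {R : realType} (p : 'rV[R]_2) (r l : R).
Hypotheses (hp : hyp_space p) (r0 : 0 < r).

Let u (x : 'rV[R]_2) : R := rad_F l (hypcosh p x).

Let near_dF x : hyp_space x ->
  \forall c \near hypcosh p x, is_derive (c : R) 1 (rad_F l) (rad_F1 l c).
Proof.
move=> xU; have C0 : 0 < hypcosh p x := lt_le_trans ltr01 (hypcosh_ge1 hp xU).
near=> c; apply: is_derive_rad_F; near: c; exact: lt_nbhsr.
Unshelve. all: by end_near. Qed.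

Let dF1 x : hyp_space x ->
  is_derive (hypcosh p x) 1 (rad_F1 l) (rad_F2 l (hypcosh p x)).
Proof. by move=> /(hypcosh_ge1 hp)/(lt_le_trans ltr01); exact: is_derive_rad_F1. Qed.

Let u_C2 : C2_on (@hyp_space R 2) u.
Proof.
move=> x xU i j.
have C0 : 0 < hypcosh p x := lt_le_trans ltr01 (hypcosh_ge1 hp xU).
have cC := hypcosh_continuous hp xU.
have cF1 : {for x, continuous (fun y => rad_F1 l (hypcosh p y))}.
  apply: (@continuous_comp _ _ _ (hypcosh p) (rad_F1 l)) => //.
  exact: is_derive_continuous (dF1 xU).
split.
- by case: (partial_radial hp i xU (nbhs_singleton (near_dF xU))).
- apply: (near_eq_continuous (partial_radialE hp i xU (near_dF xU))).
  by apply: continuous_at_mul => //; exact: dhypcosh_continuous.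
- by case: (is_derive_partial_radial hp i j xU (near_dF xU) (dF1 xU)).
- apply: (@near_eq_continuous _ _ (fun y => rad_F1 l (hypcosh p y) * ddhypcosh p i j y
     + rad_F2 l (hypcosh p y) * dhypcosh p i y * dhypcosh p j y)).
    near=> y.
    have yU : hyp_space y by near: y; exact: open_nbhs_nbhs (conj hyp_space_open xU).
    by have [_ <-] := is_derive_partial_radial hp i j yU (near_dF yU) (dF1 yU).
  apply: continuous_at_add.
    by apply: continuous_at_mul => //; exact: ddhypcosh_continuous.
  apply: continuous_at_mul; last exact: dhypcosh_continuous.
  apply: continuous_at_mul; last exact: dhypcosh_continuous.
  apply: (@continuous_comp _ _ _ (hypcosh p) (rad_F2 l)) => //.
  exact: rad_F2_continuous.
Unshelve. all: by end_near. Qed.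

Lemma radial_dirichlet_eigenvalue : rad_F l (cosh r) = 0 ->
  dirichlet_eigenvalue hyp_metric (hyp_ball p r) l.
Proof.
move=> Fr; exists u.
have BU x : hyp_ball p r x -> hyp_space x by rewrite hyp_ballE// => -[].
split.
- by move=> x /BU; exact: u_C2.
- apply: continuous_in_subspaceT => x; rewrite inE => /closure_hyp_ball-/(_ hp r0)[xU _].
  have C0 : 0 < hypcosh p x := lt_le_trans ltr01 (hypcosh_ge1 hp xU).
  apply: (@continuous_comp _ _ _ (hypcosh p) (rad_F l)).
    exact: hypcosh_continuous.
  exact: is_derive_continuous (is_derive_rad_F l C0).
- by move=> x /boundary_hyp_ball-/(_ hp r0) xr; rewrite /u xr.
- exists p; first by rewrite hyp_ballE//=; split => //; rewrite hypcoshxx -cosh0 ltr_cosh.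
  by rewrite /u hypcoshxx /rad_F /tanh2half subrr mul0r rad_y0 oner_eq0.
- move=> x /BU xU.
  have C0 : 0 < hypcosh p x := lt_le_trans ltr01 (hypcosh_ge1 hp xU).
  by rewrite (laplacian_radial hp xU (near_dF xU) (dF1 xU)) rad_F_ode// mulNr opprK.
Qed.

End RadialEigenfunction.

(** * Shooting in the eigenvalue parameter *)

Section Shooting.
Context {R : realType}.
Implicit Types (l t T : R).

(** The equation reads [(t y')' = - l y / (1 - t)^2 <= 0], so [t y'] decreases from its value 0 at
    [t = 0]. *)
Lemma rad_y1_le0 l T : 0 <= l -> T < 1 -> (forall t, 0 <= t <= T -> 0 <= rad_y l t) ->
  forall t, 0 < t <= T -> rad_y1 l t <= 0.
Proof.
move=> l0 T1 y0 t /andP[t0 tT].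
have lt1 s : 0 <= s <= T -> `|s| < 1.
  by move=> /andP[s0 sT]; rewrite ger0_norm// (le_lt_trans sT).
have := @nonincreasing_of_is_derive R (fun s => s * rad_y1 l s)
  (fun s => s * rad_y2 l s + rad_y1 l s * 1) 0 T.
have H1 s : 0 <= s <= T -> is_derive (s : R) 1 (fun s => s * rad_y1 l s)
    (s * rad_y2 l s + rad_y1 l s * 1).
  by move=> /lt1 s1; exact: is_derive_mul (is_derive_id s 1) (is_derive_rad_y1 l s1).
have H2 s : 0 <= s <= T -> s * rad_y2 l s + rad_y1 l s * 1 <= 0.
  move=> sT; have s1 := lt1 _ sT; have := rad_y_ode l s1; rewrite mulr1 => ode.
  have q0 : 0 < (1 - s) ^+ 2.
    by rewrite exprn_gt0// subr_gt0 (le_lt_trans (ler_norm _) s1).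
  by rewrite -(pmulr_rle0 _ q0) ode mulNr oppr_le0 mulr_ge0// y0.
move=> /(_ H1 H2 0 t (lexx 0) (ltW t0) tT).
by rewrite mul0r pmulr_rle0.
Qed.

Lemma rad_y_nonincreasing l T : 0 <= l -> T < 1 ->
  (forall t, 0 <= t <= T -> 0 <= rad_y l t) ->
  forall s t, 0 <= s -> s <= t -> t <= T -> rad_y l t <= rad_y l s.
Proof.
move=> l0 T1 y0 s t s0 st tT.
have lt1 x : 0 <= x <= T -> `|x| < 1.
  by move=> /andP[x0 xT]; rewrite ger0_norm// (le_lt_trans xT).
have cy : {within `[0, T], continuous (rad_y l)}.
  by apply: (@is_derive_within _ _ (rad_y1 l)) => x /lt1; exact: is_derive_rad_y.
apply: (@ler0_derive1_le_cc R (rad_y l) 0 T) => //.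
- move=> x; rewrite in_itv/= => /andP[x0 xT].
  by have [] : is_derive x 1 (rad_y l) (rad_y1 l x);
    first by apply/is_derive_rad_y/lt1; rewrite !ltW.
- move=> x; rewrite in_itv/= => /andP[x0 xT].
  have [_] : is_derive x 1 (rad_y l) (rad_y1 l x).
    by apply/is_derive_rad_y/lt1; rewrite !ltW.
  by rewrite derive1E => ->; apply: (rad_y1_le0 l0 T1 y0); rewrite x0 ltW.
- by rewrite in_itv/= (le_trans s0 st) tT.
- by rewrite in_itv/= s0 (le_trans st tT).
Qed.

Lemma rad_y_eq1 t : rad_y 0 t = 1.
Proof.
rewrite -[RHS](rad_y0 0) rad_y0; apply/cvg_lim => //; rewrite -cvg_shiftS.
have -> : (fun n => pseries (rad_a 0) t n.+1) = cst (1 : R).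
  apply/funext => n; rewrite /pseries /series/= big_nat_recl//= expr0 mulr1.
  by rewrite big1 ?addr0// => k _; rewrite rad_aS oppr0 !mul0r.
exact: cvg_cst.
Qed.

Lemma exists_first_zero (L T : R) : 0 <= L -> 0 <= T < 1 ->
  (exists2 t, 0 <= t <= T & rad_y L t <= 0) ->
  exists2 mu, 0 <= mu <= L & rad_y mu T = 0.
Proof.
move=> L0 /[dup] T01 /andP[T0 T1] [tL tLT yL].
have [C [C0 lip]] := rad_y_lipschitz L0 T01.
pose A := [set l : R | 0 <= l <= L /\ exists2 t, 0 <= t <= T & rad_y l t <= 0].
have AL : A L by split; [rewrite L0 lexx|exists tL].
have Alb : lbound A 0 by move=> l [/andP[]].
have Ai : has_inf A by split; [exists L|exists 0].
pose mu := inf A.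
have mu0 : 0 <= mu by apply: lb_le_inf => //; exists L.
have muL : mu <= L by apply: ge_inf => //; exists 0.
have mun : `|mu| <= L by rewrite ger0_norm.
have below l : 0 <= l < mu -> forall t, 0 <= t <= T -> 0 < rad_y l t.
  move=> /andP[l0 lmu] t tT; rewrite ltNge; apply/negP => yl.
  have lL := ltW (lt_le_trans lmu muL).
  move: lmu; rewrite ltNge => /negP; apply; apply: ge_inf; first by exists 0.
  by split; [rewrite l0 lL|exists t].
have ymu0 t : 0 <= t <= T -> 0 <= rad_y mu t.
  move=> tT; have [mu00|mun0] := eqVneq mu 0; first by rewrite mu00 rad_y_eq1.
  have mupos : 0 < mu by rewrite lt_def mun0.
  rewrite leNgt; apply/negP => yneg.
  (* A parameter [mu - e >= 0] below [mu] at which, by the Lipschitz bound, [y] would still be at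
     most 0 at [t], against [below]. *)
  pose e := Num.min mu (- rad_y mu t / C).
  have e0 : 0 < e by rewrite lt_min mupos divr_gt0// oppr_gt0.
  have emu : e <= mu by rewrite ge_min lexx.
  have eC : C * e <= - rad_y mu t.
    by rewrite mulrC -ler_pdivlMr// /e ge_min lexx orbT.
  have l0 : 0 <= mu - e by rewrite subr_ge0.
  have lmu : mu - e < mu by rewrite ltrBlDr ltrDl.
  have ln : `|mu - e| <= L by rewrite ger0_norm// (le_trans (ltW lmu)).
  have pos := below (mu - e) (introT andP (conj l0 lmu)) t tT.
  have := lip (mu - e) mu t ln mun tT.
  have -> : mu - e - mu = - e by ring.
  rewrite normrN (gtr0_norm e0) => /(le_trans (ler_norm _)); lra.
have [t tT yt] : exists2 t, 0 <= t <= T & rad_y mu t <= 0.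
  apply: contrapT => /forall2NP ypos.
  have ypos' t : 0 <= t <= T -> 0 < rad_y mu t.
    by move=> tT; have [//|/negP] := ypos t; rewrite -ltNge.
  have cy : {within `[0, T], continuous (rad_y mu)}.
    apply: (@is_derive_within _ _ (rad_y1 mu)) => x /andP[x0 xT].
    by apply: is_derive_rad_y; rewrite ger0_norm// (le_lt_trans xT).
  have [t0 t0T t0min] := EVT_min T0 cy.
  rewrite in_itv/= in t0T.
  have m0 := ypos' _ t0T; pose m := rad_y mu t0.
  (* If [y] had a positive minimum [m] at [mu], it would stay positive for parameters within [m / C]
     of [mu], yet the infimum has members of [A] that close. *)
  have [l Al lmu] := inf_adherent (divr_gt0 m0 C0) Ai.
  have [/andP[l0 lL] [t tT ylt]] := Al.
  have mul : mu <= l by apply: ge_inf => //; exists 0.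
  have ln : `|l| <= L by rewrite ger0_norm.
  have := lip mu l t mun ln tT; rewrite [leRHS](_ : _ = C * (l - mu)); last first.
    by rewrite distrC ger0_norm// subr_ge0.
  move=> lipl.
  have : C * (l - mu) < m.
    by rewrite mulrC -ltr_pdivlMr// ltrBlDl.
  have := t0min t; rewrite in_itv/= tT => /(_ isT) mt.
  have := ler_norm (rad_y mu t - rad_y l t); rewrite /m; lra.
exists mu; first by rewrite mu0 muL.
(* Being nonnegative, the solution is nonincreasing, so a zero anywhere in [[0, T]] forces one at
   [T]. *)
apply/eqP; rewrite eq_le ymu0 ?lexx ?T0// andbT.
apply: le_trans yt; move/andP: tT => [t0 tT].
exact: rad_y_nonincreasing ymu0 _ _ t0 tT (lexx T).
Qed.

End Shooting.

(** * Sturm comparison at the claimed bound *)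

Section SturmComparison.
Context {R : realType} (r : R).
Hypothesis r0 : 0 < r.

Let sinh2_gt0 (t : R) : 0 < t -> 0 < 4 * sinh t ^+ 2.
Proof. by move=> t0; apply: mulr_gt0 => //; rewrite exprn_gt0// sinh_gt0. Qed.

Let k : R := pi / r.
Let Lam : R := 1 / 4 + pi ^+ 2 / r ^+ 2 - 1 / (4 * sinh r ^+ 2).

(** Monotonicity of the radial solution asks for a nonnegative parameter; [sinh r >= r] and
    [pi >= 2] suffice. *)
Lemma sturm_bound_ge0 : 0 <= Lam.
Proof.
have s0 := sinh_gt0 r0.
have h1 : 1 / (4 * sinh r ^+ 2) <= 1 / (4 * r ^+ 2).
  have r2 : 0 < 4 * r ^+ 2 by rewrite mulr_gt0// exprn_gt0.
  rewrite !div1r lef_pV2 ?posrE ?sinh2_gt0//.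
  by rewrite ler_pM2l// lerXn2r ?nnegrE ?ge_sinh// ltW.
have h2 : 1 / (4 * r ^+ 2) <= pi ^+ 2 / r ^+ 2.
  rewrite invfM mulrA ler_pM2r ?invr_gt0 ?exprn_gt0//.
  by have := pi_ge2 R; nra.
by rewrite /Lam; lra.
Qed.

Let Y (t : R) : R := rad_F Lam (cosh t).
Let Y1 (t : R) : R := rad_F1 Lam (cosh t) * sinh t.
Let Y2 (t : R) : R := rad_F2 Lam (cosh t) * sinh t ^+ 2 + rad_F1 Lam (cosh t) * cosh t.

Let dY (t : R) : is_derive t 1 Y (Y1 t).
Proof.
exact: (is_derive_compR (is_derive_cosh t) (is_derive_rad_F Lam (cosh_gt0 t))).
Qed.

Let dY1 (t : R) : is_derive t 1 Y1 (Y2 t).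
Proof.
apply: (is_derive_val (is_derive_mul (is_derive_compR (is_derive_cosh t)
  (is_derive_rad_F1 Lam (cosh_gt0 t))) (is_derive_sinh t))).
by rewrite /Y2; ring.
Qed.

Let Y_ode (t : R) : 0 < t -> Y2 t = - (cosh t / sinh t) * Y1 t - Lam * Y t.
Proof.
move=> t0; have s0 := lt0r_neq0 (sinh_gt0 t0).
have := rad_F_ode Lam (cosh_gt0 t).
have -> : cosh t ^+ 2 - 1 = sinh t ^+ 2 by have := cosh2Bsinh2 t; lra.
rewrite mulNr -/(Y t) => ode; rewrite -ode.
by rewrite /Y2 /Y1; field.
Qed.

(* The Wronskian of [sqrt (sinh t) * Y t] and [sin (k t)]. *)
Let W (t : R) : R := sinh_weight 1 t *
  ((1 / 2 * (cosh t / sinh t) * Y t + Y1 t) * sin (k * t) - Y t * (k * cos (k * t))).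

(** The function [z = sqrt (sinh t) Y] solves [z'' = (1/4 - 1 / (4 sinh^2 t) - Lam) z], whereas
    [sin (k t)] has second derivative [- k^2 sin (k t)]; this is the resulting derivative of the
    Wronskian. *)
Let W' (t : R) : R := sinh_weight 1 t * Y t * sin (k * t) *
  (1 / (4 * sinh r ^+ 2) - 1 / (4 * sinh t ^+ 2)).

Let dW (t : R) : 0 < t -> is_derive t 1 W (W' t).
Proof.
move=> t0; have s0 := lt0r_neq0 (sinh_gt0 t0); have sr0 := lt0r_neq0 (sinh_gt0 r0).
have dkt : is_derive t 1 (fun t => k * t) k.
  by apply: (is_derive_val (is_derive_scale k (is_derive_id t 1))); rewrite mulr1.
have dsin := is_derive_compR dkt (is_derive_sin (k * t)).
have dcos := is_derive_compR dkt (is_derive_cos (k * t)).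
have dcoth := is_derive_mul (is_derive_cosh t) (is_derive_inv (is_derive_sinh t) s0).
apply: (is_derive_val (is_derive_mul (is_derive_sinh_weight 1 t0)
  (is_derive_sub (is_derive_mul (is_derive_add
     (is_derive_mul (is_derive_scale (1 / 2) dcoth) (dY t)) (dY1 t)) dsin)
     (is_derive_mul (dY t) (is_derive_scale k dcos))))).
rewrite /W' /= Y_ode//.
have -> : cosh t * (- cosh t / sinh t ^+ 2) + (sinh t)^-1 * sinh t
   = 1 - (cosh t / sinh t) ^+ 2 by field.
have e : (cosh t / sinh t) ^+ 2 = 1 + (sinh t ^+ 2)^-1.
  rewrite expr_div_n; have -> : cosh t ^+ 2 = 1 + sinh t ^+ 2.
    by have := cosh2Bsinh2 t; lra.
  by field.
set c := cosh t / sinh t in e *; set g := sinh_weight 1 t.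
have -> : 1 / (4 * sinh t ^+ 2) = (c ^+ 2 - 1) / 4 by rewrite e; field.
(* Here the value of [Lam] enters: it makes the last factor of [W'] vanish at [r] and be negative
   before. *)
have -> : 1 / (4 * sinh r ^+ 2) = 1 / 4 + k ^+ 2 - Lam.
  by rewrite /Lam /k; field; rewrite sr0 gt_eqF.
by field.
Qed.

(** If [Y] were positive on [[0, r]], then [W r = sqrt (sinh r) k Y r > 0] and [W] would be
    nonincreasing. As [coth] is singular at 0, the vanishing of [W] there is used as a limit: [W e]
    is at most [sqrt (sinh e)] times a constant, below [W r] for small [e]. *)
Lemma sturm_zero : exists2 t, 0 <= t <= tanh2half (cosh r) & rad_y Lam t <= 0.
Proof.
apply: contrapT => /forall2NP ypos.
pose T := tanh2half (cosh r).
have y_gt0 t : 0 <= t <= T -> 0 < rad_y Lam t.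
  by move=> tT; have [//|/negP] := ypos t; rewrite -ltNge.
have T1 : T < 1 by rewrite (le_lt_trans (ler_norm _))// tanh2half_norm// cosh_gt0.
have yT t : 0 <= t <= r -> 0 <= tanh2half (cosh t) <= T.
  move=> /andP[t0 tr]; rewrite tanh2half_ge0 ?cosh_ge1//= /T.
  by rewrite tanh2half_le ?cosh_gt0// ler_cosh.
have Ypos t : 0 <= t <= r -> 0 < Y t by move=> /yT; exact: y_gt0.
have y_ge0 t : 0 <= t <= T -> 0 <= rad_y Lam t by move=> /y_gt0/ltW.
have Yle1 t : 0 <= t <= r -> Y t <= 1.
  move=> /yT /andP[h1 h2]; rewrite -(rad_y0 Lam).
  exact: (rad_y_nonincreasing sturm_bound_ge0 T1 y_ge0 (lexx 0) h1 h2).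
have Y1le0 t : 0 < t <= r -> Y1 t <= 0.
  move=> /andP[t0 tr]; have st := sinh_gt0 t0.
  have c1 : 1 < cosh t by rewrite -cosh0 ltr_cosh.
  rewrite /Y1 pmulr_lle0// /rad_F1 pmulr_lle0; last first.
    by rewrite divr_gt0// exprn_gt0// addr_gt0// cosh_gt0.
  apply: (rad_y1_le0 sturm_bound_ge0 T1 y_ge0).
  have /andP[_ ->] : 0 <= tanh2half (cosh t) <= T by apply: yT; rewrite tr ltW.
  by rewrite andbT divr_gt0 ?subr_gt0// addr_gt0// cosh_gt0.
have k0 : 0 < k by rewrite divr_gt0// pi_gt0.
have kr : k * r = pi by rewrite /k divfK// gt_eqF.
have sin_ge0 t : 0 <= t <= r -> 0 <= sin (k * t).
  move=> /andP[t0 tr]; apply: sin_ge0_pi.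
  by rewrite mulr_ge0 ?(ltW k0)//= -kr ler_pM2l.
have Wr : 0 < W r.
  rewrite /W kr sinpi cospi mulr0 mulrN1 mulrN opprK add0r.
  by rewrite mulr_gt0 ?sinh_weight_gt0// mulr_gt0// Ypos// lexx ltW.
have Wmono e : 0 < e <= r -> W r <= W e.
  move=> /andP[e0 er].
  have dWe t : e <= t <= r -> is_derive (t : R) 1 W (W' t).
    by move=> /andP[et _]; exact: dW (lt_le_trans e0 et).
  apply: (nonincreasing_of_is_derive dWe _ (lexx e) er (lexx r)).
  move=> t /andP[et tr]; have t0 : 0 < t := lt_le_trans e0 et.
  have tr0 : 0 <= t <= r by rewrite tr ltW.
  apply: mulr_ge0_le0.
    by rewrite mulr_ge0 ?sin_ge0// mulr_ge0 ?(ltW (Ypos _ tr0))// ltW// sinh_weight_gt0.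
  rewrite subr_le0 !div1r lef_pV2 ?posrE ?sinh2_gt0//.
  rewrite ler_pM2l// lerXn2r ?nnegrE ?(ltW (sinh_gt0 _))//.
  by move: tr; rewrite le_eqVlt => /predU1P[->//|/ltr_sinh/ltW].
have Wsmall e : 0 < e <= r / 2 -> W e <= sinh_weight 1 e * (cosh r * k).
  move=> /andP[e0 er].
  have er' : e <= r by lra.
  have e0r : 0 <= e <= r by rewrite er' ltW.
  have se := sinh_gt0 e0.
  rewrite /W ler_pM2l ?sinh_weight_gt0//.
  have h1 : 0 <= Y e * (k * cos (k * e)).
    rewrite mulr_ge0 ?(ltW (Ypos _ e0r))// mulr_ge0 ?(ltW k0)// cos_ge0_pihalf//.
    have ke : 0 <= k * e by rewrite mulr_ge0 ?ltW.
    have : k * e <= pi / 2 by rewrite -kr -mulrA ler_pM2l.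
    by have := pi_ge0 R; move=> *; apply/andP; split; lra.
  have h2 : Y1 e * sin (k * e) <= 0.
    by rewrite mulr_le0_ge0 ?sin_ge0// Y1le0// e0.
  have h3 : cosh e / sinh e * Y e * sin (k * e) <= cosh r * k.
    have ske : sin (k * e) <= k * sinh e.
      apply: le_trans (ge_sin _) _; first by rewrite mulr_ge0 ?ltW.
      by rewrite ler_pM2l// ge_sinh// ltW.
    apply: (@le_trans _ _ (cosh e / sinh e * 1 * (k * sinh e))).
      apply: ler_pM => //; [|exact: sin_ge0|].
        by rewrite mulr_ge0 ?(ltW (Ypos _ e0r))// divr_ge0 ?(ltW (cosh_gt0 _))// ltW.
      by rewrite ler_wpM2l ?Yle1// divr_ge0 ?(ltW (cosh_gt0 _))// ltW.
    have -> : cosh e / sinh e * 1 * (k * sinh e) = cosh e * k.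
      by field; rewrite gt_eqF.
    by rewrite ler_pM2r// ler_cosh// ltW.
  have h4 : 0 <= cosh e / sinh e * Y e * sin (k * e).
    rewrite mulr_ge0 ?sin_ge0// mulr_ge0 ?(ltW (Ypos _ e0r))//.
    by rewrite divr_ge0 ?(ltW (cosh_gt0 _))// ltW.
  lra.
have ck0 : 0 < cosh r * k by rewrite mulr_gt0 ?cosh_gt0.
have cw : {for (0 : R), continuous (sinh_weight 1)}.
  apply: (@continuous_comp _ _ _ (fun t => sinh t ^+ 1) Num.sqrt).
    by apply: continuous_at_exp; exact: is_derive_continuous (is_derive_sinh _).
  exact: sqrt_continuous.
have w0 : sinh_weight 1 0 = 0 :> R by rewrite /sinh_weight sinh0 expr1 sqrtr0.
have : \forall e \near (0 : R), sinh_weight 1 e < W r / (cosh r * k).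
  have cw' : sinh_weight 1 e @[e --> (0 : R)] --> sinh_weight 1 (0 : R) := cw.
  by apply: (cvgr_lt _ cw'); rewrite w0 divr_gt0.
move=> /nbhs_ballP[d /= d0 Hd].
pose e := Num.min (d / 2) (r / 2).
have e0 : 0 < e by rewrite lt_min !divr_gt0.
have er : e <= r / 2 by rewrite ge_min lexx orbT.
have ed : e < d.
  have : e <= d / 2 by rewrite ge_min lexx.
  by lra.
have := Hd e; rewrite /ball/= sub0r normrN gtr0_norm// => /(_ ed).
rewrite ltr_pdivlMr//; apply/negP; rewrite -leNgt.
apply: le_trans (Wsmall e _); last by rewrite e0.
by apply: Wmono; rewrite e0/=; lra.
Qed.

End SturmComparison.

Lemma first_dirichlet_eigenvalue_le (R : realType) (p : 'rV[R]_2) (r lambda1 : R) :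
  hyp_space p -> 0 < r ->
  first_dirichlet_eigenvalue hyp_metric (hyp_ball p r) lambda1 ->
  lambda1 <= 1 / 4 + pi ^+ 2 / r ^+ 2 - 1 / (4 * sinh r ^+ 2).
Proof.
move=> hp r0 [_ least].
have T01 : 0 <= tanh2half (cosh r) < 1.
  rewrite tanh2half_ge0 ?cosh_ge1//=.
  by rewrite (le_lt_trans (ler_norm _))// tanh2half_norm// cosh_gt0.
have [mu /andP[_ muL] mu0] := exists_first_zero (sturm_bound_ge0 r0) T01 (sturm_zero r0).
apply: le_trans muL; apply: least.
exact: radial_dirichlet_eigenvalue.
Qed.

Unset Implicit Arguments.

Theorem lemma2p1 (R : realType) (n : nat) (p : 'rV[R]_n) (r lambda1 : R)
    (hp : hyp_space p) (hr : 0 < r)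
    (hlambda1 : first_dirichlet_eigenvalue hyp_metric (hyp_ball p r) lambda1) :
  ((3 < n)%N ->
     lambda1 > (n%:R - 1) ^+ 2 / 4 + pi ^+ 2 / r ^+ 2
               + (n%:R - 1) * (n%:R - 3) / (4 * sinh r ^+ 2)) /\
  (n = 2%N ->
     lambda1 <= 1 / 4 + pi ^+ 2 / r ^+ 2 - 1 / (4 * sinh r ^+ 2)).
Proof.
split; first by move=> n3; exact: dirichlet_eigenvalue_gt hp hr n3 hlambda1.1.
move=> n2; rewrite n2 in p hp hlambda1.
exact: first_dirichlet_eigenvalue_le hp hr hlambda1.
Qed.
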